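(* Let $\lambda\in\mathbb{C}$, let $v_\lambda$ be the highest weight vector of the generalized Verma module $M_\lambda:=M^{so(7)}_{\mathfrak p}(\mathbb C_\lambda)$ (scalar type, induced from the character of $\mathfrak p=\mathfrak p_{(1,0,0)}$ of weight $\lambda\varepsilon_1$), and let $u_1:=g_{-(\varepsilon_1-\varepsilon_2)}\,g_{-(\varepsilon_1+\varepsilon_2)}+g_{-(\varepsilon_1+\varepsilon_3)}\,g_{-(\varepsilon_1-\varepsilon_3)}$ and $u_2:=(g_{-\varepsilon_1})^2$, regarded as elements of $U(\mathfrak n_-)=S(\mathfrak n_-)$. Let $N$ be a positive integer, let $A_0,\dots,A_N\in\mathbb C$ be complex numbers at least one of which is non-zero, and put $$u\cdot v_\lambda:=\sum_{k=0}^N A_k u_1^k u_2^{N-k}\cdot v_\lambda .$$ 1. The vector $u\cdot v_\lambda$ is $(i(\mathrm{Lie}\,G_2)\cap\mathfrak p)$-singular (a ''singular vector of scalar type'') of homogeneity $2N$ if and only if $\lambda=N-\frac52$ and, up to a nonzero scalar factor, $u=(4u_1+u_2)^N=(4u_1+u_2)^{\lambda+5/2}$. 2. The module $M_\lambda$ has no $(i(\mathrm{Lie}\,G_2)\cap\mathfrak p)$-singular vector of homogeneity $2N+1$. 3. A vector $v\in M_\lambda$, not proportional to $v_\lambda$, is $(so(7)\cap\mathfrak p)$-singular if and only if, for some positive integer $N$, $\lambda=N-\frac52$ and $v$ is the vector given in part 1, i.e. $v=(4u_1+u_2)^N\cdot v_\lambda$ up to a nonzero scalar factor.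
   Context: All Lie algebras are over $\mathbb C$. The algebra $so(7)$. Let $V=\mathbb C^7$ have basis $e_1,e_2,e_3,e_0,e_{-1},e_{-2},e_{-3}$ with dual basis $e_j^*$, and symmetric bilinear form $B(e_i,e_j)=1$ if $i=-j$ and $0$ otherwise (so $B(e_0,e_0)=1$). Let $so(7)$ be the Lie algebra of endomorphisms of $V$ skew with respect to $B$, where $v\otimes w^*$ denotes the endomorphism $x\mapsto w^*(x)v$. The Cartan subalgebra $\mathfrak h$ is spanned by $h_{\varepsilon_i}:=e_i\otimes e_i^*-e_{-i}\otimes e_{-i}^*$, $i=1,2,3$, and $\varepsilon_1,\varepsilon_2,\varepsilon_3$ is the basis of $\mathfrak h^*$ with $\varepsilon_i(h_{\varepsilon_j})=\delta_{ij}$. Positive roots: $\varepsilon_i\pm\varepsilon_j$ ($i<j$) and $\varepsilon_i$. Root vectors for positive roots: for $i<j$, $g_{\varepsilon_i-\varepsilon_j}=e_i\otimes e_j^*-e_{-j}\otimes e_{-i}^*$, $g_{\varepsilon_i+\varepsilon_j}=e_i\otimes e_{-j}^*-e_j\otimes e_{-i}^*$, and $g_{\varepsilon_i}=\sqrt2\,(e_i\otimes e_0^*-e_0\otimes e_{-i}^* )$. For negative roots, $g_{-\alpha}$ is the transpose of $g_\alpha$ in the given basis; thus for $i<j$, $g_{-(\varepsilon_i-\varepsilon_j)}=e_j\otimes e_i^*-e_{-i}\otimes e_{-j}^*$, $g_{-(\varepsilon_i+\varepsilon_j)}=e_{-j}\otimes e_i^*-e_{-i}\otimes e_j^*$, and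 $g_{-\varepsilon_i}=\sqrt2\,(e_0\otimes e_i^*-e_{-i}\otimes e_0^* )$. The embedding $i:\mathrm{Lie}\,G_2\hookrightarrow so(7)$. Its image $i(\mathrm{Lie}\,G_2)$ is the $14$-dimensional simple Lie subalgebra generated by $g_{\pm(\varepsilon_2-\varepsilon_3)}$ and $g_{\pm(\varepsilon_1-\varepsilon_2)}+g_{\pm\varepsilon_3}$ (the images of the simple root vectors $g'_{\pm2}$, for the long simple root $\alpha_2$, and $g'_{\pm1}$, for the short simple root $\alpha_1$). Its Cartan subalgebra is $i(\mathfrak h')=i(\mathrm{Lie}\,G_2)\cap\mathfrak h$. Parabolic subalgebras. $\mathfrak p=\mathfrak p_{(1,0,0)}=\mathfrak l\oplus\mathfrak n$, where $\mathfrak l$ is spanned by $\mathfrak h$ and the root vectors $g_{\pm\varepsilon_2\pm\varepsilon_3},g_{\pm\varepsilon_2},g_{\pm\varepsilon_3}$, and $\mathfrak n$ is spanned by $g_{\varepsilon_1},g_{\varepsilon_1\pm\varepsilon_2},g_{\varepsilon_1\pm\varepsilon_3}$. The opposite nilradical $\mathfrak n_-$, spanned by $g_{-\varepsilon_1},g_{-\varepsilon_1\pm\varepsilon_2},g_{-\varepsilon_1\pm\varepsilon_3}$, is abelian, so $U(\mathfrak n_-)=S(\mathfrak n_-)$ is a polynomial ring. The subalgebra $i(\mathrm{Lie}\,G_2)\cap\mathfrak p$ is the image of the parabolic subalgebra of $\mathrm{Lie}\,G_2$ with Levi decomposition $\mathfrak l'\oplus\mathfrak n'$, where $\mathfrak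 l'$ has roots $\pm\alpha_2$, and $\mathfrak n'$ is the sum of the root spaces of the positive roots other than $\alpha_2$. Here $i([\mathfrak l',\mathfrak l'])\simeq sl(2)$ is spanned by $g_{\pm(\varepsilon_2-\varepsilon_3)}$ and $h_{\varepsilon_2}-h_{\varepsilon_3}$. The module. $\mathbb C_\lambda$ is the one-dimensional $\mathfrak p$-module on which $\mathfrak n$ and $[\mathfrak l,\mathfrak l]$ act by $0$ and $\mathfrak h$ acts by the weight $\lambda\varepsilon_1$; $M_\lambda=U(so(7))\otimes_{U(\mathfrak p)}\mathbb C_\lambda\simeq S(\mathfrak n_-)\otimes\mathbb C_\lambda$, and $v_\lambda=1\otimes1$. A vector $q\cdot v_\lambda$ with $q\in S(\mathfrak n_-)$ a homogeneous polynomial of degree $d$ is said to have homogeneity $d$. Singular vectors (of scalar type). A nonzero vector of $M_\lambda$ is $(i(\mathrm{Lie}\,G_2)\cap\mathfrak p)$-singular if it is an $i(\mathfrak h')$-weight vector annihilated by $i(\mathfrak n')$ and by $i([\mathfrak l',\mathfrak l'])$. A nonzero vector is $(so(7)\cap\mathfrak p)$-singular if it is an $\mathfrak h$-weight vector annihilated by $\mathfrak n$ and by $[\mathfrak l,\mathfrak l]\simeq so(5)$. *)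

(* Defs.v *)
From HB Require Import structures.
From mathcomp Require Import all_boot all_order all_algebra.
From mathcomp Require Import boolp classical_sets reals complex.
From mathcomp Require Import monalg.
From mathcomp Require Import ring.

Set Implicit Arguments.
Unset Strict Implicit.
Unset Printing Implicit Defensive.

Import GRing.Theory Num.Theory.
Local Open Scope classical_set_scope.
Local Open Scope ring_scope.
Local Open Scope quotient_scope.

Section Span.
Variables (K : fieldType) (V : lmodType K).

Definition subspace (W : set V) : Prop :=
  W 0 /\ forall (a : K) u v, W u -> W v -> W (a *: u + v).

Definition lspan (A : set V) : set V :=
  [set v | forall W, subspace W -> A `<=` W -> W v].

Lemma lspan_subspace A : subspace (lspan A).
Proof.
split=> [W [W0 _] _ //|a u v Au Av W sW AW].
by apply: sW.2; [apply: Au | apply: Av].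
Qed.

Lemma sub_lspan A : A `<=` lspan A.
Proof. by move=> v Av W _; apply. Qed.

Lemma lspan_min A W : subspace W -> A `<=` W -> lspan A `<=` W.
Proof. by move=> sW AW v; apply. Qed.

Definition span_pred (A : set V) : {pred V} := fun v => `[< lspan A v >].

Lemma span_pred_zmod_closed A : zmod_closed (span_pred A).
Proof.
have [S0 SD] := lspan_subspace A; split=> [|u v /asboolP Au /asboolP Av].
  exact/asboolP.
by apply/asboolP; rewrite addrC -scaleN1r; apply: SD.
Qed.
HB.instance Definition _ A :=
  GRing.isZmodClosed.Build V (span_pred A) (span_pred_zmod_closed A).

Definition lquot (A : set V) : Type := Quotient.quot (span_pred A).
HB.instance Definition _ A := GRing.Zmodule.on (lquot A).

(* The locks here and below only keep unification from unfolding quotients. *)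
Fact lquot_key : unit. Proof. by []. Qed.

Definition lproj (A : set V) : V -> lquot A :=
  locked_with lquot_key (fun v => \pi_(Quotient.quot (span_pred A)) v).

Definition lrepr (A : set V) : lquot A -> V :=
  locked_with lquot_key (fun x => repr (x : Quotient.quot (span_pred A))).

Section Quot.
Variable A : set V.

Lemma lprojE v : lproj A v = \pi_(Quotient.quot (span_pred A)) v.
Proof. by rewrite /lproj locked_withE. Qed.

Lemma lreprE (x : lquot A) : lrepr x = repr (x : Quotient.quot (span_pred A)).
Proof. by rewrite /lrepr locked_withE. Qed.

Lemma lreprK (x : lquot A) : lproj A (lrepr x) = x.
Proof. by rewrite lprojE lreprE; exact: reprK. Qed.

Lemma lproj_eq u v : lproj A u = lproj A v <-> lspan A (u - v).
Proof.
rewrite !lprojE; split=> [/eqP|Auv].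
  by rewrite -Quotient.idealrBE => /asboolP.
by apply/eqP; rewrite -Quotient.idealrBE; apply/asboolP.
Qed.

Lemma lproj_is_zmod_morphism : zmod_morphism (lproj A).
Proof. by move=> x y; rewrite !lprojE raddfB. Qed.
HB.instance Definition _ :=
  GRing.isZmodMorphism.Build V (lquot A) (lproj A) lproj_is_zmod_morphism.

Lemma lproj_repr v : lspan A (lrepr (lproj A v) - v).
Proof. by apply/lproj_eq; rewrite lreprK. Qed.

Definition lquot_scale : K -> lquot A -> lquot A :=
  locked_with lquot_key (fun a x => lproj A (a *: lrepr x)).

Lemma lproj_scale a v : lquot_scale a (lproj A v) = lproj A (a *: v).
Proof.
rewrite /lquot_scale locked_withE; apply/lproj_eq; rewrite -scalerBr -[_ *: _]addr0.
by apply: (lspan_subspace A).2; [exact: lproj_repr | exact: (lspan_subspace A).1].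
Qed.

Fact lquot_scaleA a b x :
  lquot_scale a (lquot_scale b x) = lquot_scale (a * b) x.
Proof. by rewrite -(lreprK x) !lproj_scale scalerA. Qed.
Fact lquot_scale1 : left_id 1 lquot_scale.
Proof. by move=> x; rewrite -(lreprK x) lproj_scale scale1r. Qed.
Fact lquot_scaleDr : right_distributive lquot_scale +%R.
Proof.
move=> a x y; rewrite -(lreprK x) -(lreprK y) -raddfD !lproj_scale.
by rewrite scalerDr raddfD.
Qed.
Fact lquot_scaleDl x : {morph lquot_scale^~ x : a b / a + b}.
Proof. by move=> a b; rewrite -(lreprK x) !lproj_scale scalerDl raddfD. Qed.

HB.instance Definition _ := GRing.Zmodule_isLmodule.Build K (lquot A)
  lquot_scaleA lquot_scale1 lquot_scaleDr lquot_scaleDl.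

Lemma lproj_is_scalable : scalable (lproj A).
Proof. by move=> a v; rewrite -lproj_scale. Qed.
HB.instance Definition _ :=
  GRing.isScalable.Build K V (lquot A) *:%R (lproj A) lproj_is_scalable.
End Quot.
End Span.

HB.mixin Record Lmodule_isLieAlgebra (K : fieldType) L of GRing.Lmodule K L := {
  lie : L -> L -> L;
  lie_linearl : forall y, linear (lie^~ y);
  lie_linearr : forall x, linear (lie x);
  liexx : forall x, lie x x = 0;
  lie_jacobi : forall x y z,
    lie x (lie y z) + lie y (lie z x) + lie z (lie x y) = 0
}.

#[short(type="lieAlgType")]
HB.structure Definition LieAlgebra (K : fieldType) :=
  {L of GRing.Lmodule K L & Lmodule_isLieAlgebra K L}.

Section LieSets.
Variables (K : fieldType) (L : lieAlgType K).

Definition lie_subalg (W : set L) : Prop :=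
  subspace W /\ forall x y, W x -> W y -> W (lie x y).

Definition lie_gen (A : set L) : set L :=
  [set x | forall W, lie_subalg W -> A `<=` W -> W x].

Definition derived (A : set L) : set L :=
  lspan [set z | exists x y, [/\ A x, A y & z = lie x y]].
End LieSets.

Section Enveloping.
Variables (K : fieldType) (L : lieAlgType K).

(* The free associative algebra on the set L; the linear structure of L only
   enters through [env_rel]. *)
Definition free_alg : Type := {malg K[{fmonom L}]}.
HB.instance Definition _ := GRing.Lmodule.on free_alg.
Local Notation T := free_alg.

Definition free_mul : T -> T -> T :=
  locked_with lquot_key (fun s t : {malg K[{fmonom L}]} => s * t).

Lemma free_mulE (s t : {malg K[{fmonom L}]}) : free_mul s t = s * t.
Proof. by rewrite /free_mul locked_withE. Qed.

Fact free_mulA : associative free_mul.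
Proof. by move=> s t u; rewrite !free_mulE; exact: mulrA. Qed.
Fact free_mul1l : left_id (1 : {malg K[{fmonom L}]}) free_mul.
Proof. by move=> s; rewrite free_mulE; exact: mul1r. Qed.
Fact free_mul1r : right_id (1 : {malg K[{fmonom L}]}) free_mul.
Proof. by move=> s; rewrite free_mulE; exact: mulr1. Qed.
Fact free_mulDl : left_distributive free_mul +%R.
Proof. by move=> s t u; rewrite !free_mulE; exact: mulrDl. Qed.
Fact free_mulDr : right_distributive free_mul +%R.
Proof. by move=> s t u; rewrite !free_mulE; exact: mulrDr. Qed.
Fact free_one_neq0 : (1 : {malg K[{fmonom L}]}) != 0 :> T.
Proof. exact: oner_neq0. Qed.
HB.instance Definition _ := GRing.Zmodule_isNzRing.Build free_alg
  free_mulA free_mul1l free_mul1r free_mulDl free_mulDr free_one_neq0.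

Fact free_scaleAl (a : K) (s t : T) :
  a *: free_mul s t = free_mul (a *: s) t.
Proof. by rewrite !free_mulE; exact: scalerAl. Qed.
HB.instance Definition _ :=
  GRing.Lmodule_isLalgebra.Build K free_alg free_scaleAl.

Fact free_scaleAr (a : K) (s t : T) :
  a *: free_mul s t = free_mul s (a *: t).
Proof.
have sU c d (m : {fmonom L}) :
    c *: (<< d *g m >> : {malg K[_]}) = << c * d *g m >>.
  by apply/malgP => k; rewrite mcoeffZ !mcoeffU mulrnAr.
suff H (p q : {malg K[{fmonom L}]}) : a *: (p * q) = p * (a *: q).
  by rewrite !free_mulE; exact: H.
rewrite (monalgE p) !mulr_suml scaler_sumr; apply: eq_bigr => i _.
rewrite (monalgE q) mulr_sumr !scaler_sumr mulr_sumr; apply: eq_bigr => j _.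
by rewrite sU !malgM_def !fgmulUU sU mulrCA.
Qed.
HB.instance Definition _ :=
  GRing.Lalgebra_isAlgebra.Build K free_alg free_scaleAr.

Definition fgen (x : L) : T := (<< fmu x >> : {malg K[{fmonom L}]}).

Inductive env_rel : set T :=
| EnvLin (a : K) (x y : L) : env_rel (fgen (a *: x + y) - (a *: fgen x + fgen y))
| EnvLie (x y : L) : env_rel (fgen (lie x y) - (fgen x * fgen y - fgen y * fgen x)).

(* The elements whose linear span is the two-sided ideal generated by
   [env_rel]. *)
Definition env_ideal_gen : set T :=
  [set t | exists a r b, env_rel r /\ t = a * r * b].

Definition envel : Type := lquot env_ideal_gen.
HB.instance Definition _ := GRing.Lmodule.on envel.

Local Notation I := (lspan env_ideal_gen).
Local Notation pi := (lproj env_ideal_gen).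

Lemma env_idealMl s t : I t -> I (s * t).
Proof.
move: t; apply: lspan_min => [|_ [a [r [b [Rr ->]]]]].
  split=> [|a u v Iu Iv]; first by rewrite /= mulr0; exact: (lspan_subspace _).1.
  rewrite /= mulrDr -scalerAr.
  by apply: (lspan_subspace _).2; [exact: Iu | exact: Iv].
by apply: sub_lspan; exists (s * a), r, b; split; [exact: Rr | rewrite !mulrA].
Qed.

Lemma env_idealMr s t : I t -> I (t * s).
Proof.
move: t; apply: lspan_min => [|_ [a [r [b [Rr ->]]]]].
  split=> [|a u v Iu Iv]; first by rewrite /= mul0r; exact: (lspan_subspace _).1.
  rewrite /= mulrDl -scalerAl.
  by apply: (lspan_subspace _).2; [exact: Iu | exact: Iv].
by apply: sub_lspan; exists a, r, (b * s); split; [exact: Rr | rewrite !mulrA].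
Qed.

Definition env_one : envel := pi 1.
Definition env_mul : envel -> envel -> envel :=
  locked_with lquot_key (fun u v => pi (lrepr u * lrepr v)).

Lemma env_mulE s t : env_mul (pi s) (pi t) = pi (s * t).
Proof.
rewrite /env_mul locked_withE; apply/lproj_eq; set s' := lrepr _; set t' := lrepr _.
have -> : s' * t' - s * t = 1 *: ((s' - s) * t') + s * (t' - t).
  by rewrite scale1r mulrBl mulrBr addrA subrK.
apply: (lspan_subspace _).2.
  by apply: env_idealMr; exact: lproj_repr.
by apply: env_idealMl; exact: lproj_repr.
Qed.

Fact env_mulA : associative env_mul.
Proof.
by move=> u v w; rewrite -(lreprK u) -(lreprK v) -(lreprK w) !env_mulE mulrA.
Qed.
Fact env_mul1l : left_id env_one env_mul.
Proof. by move=> u; rewrite -(lreprK u) env_mulE mul1r. Qed.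
Fact env_mul1r : right_id env_one env_mul.
Proof. by move=> u; rewrite -(lreprK u) env_mulE mulr1. Qed.
Fact env_mulDl : left_distributive env_mul +%R.
Proof.
move=> u v w; rewrite -(lreprK u) -(lreprK v) -(lreprK w) !env_mulE.
by rewrite -!raddfD env_mulE mulrDl.
Qed.
Fact env_mulDr : right_distributive env_mul +%R.
Proof.
move=> u v w; rewrite -(lreprK u) -(lreprK v) -(lreprK w) !env_mulE.
by rewrite -!raddfD env_mulE mulrDr.
Qed.

(* The coefficient of the empty word is a morphism of algebras T -> K which
   kills [env_rel]; hence 1 <> 0 in the quotient. *)
Lemma env_one_neq0 : env_one != 0.
Proof.
pose aug : {malg K[{fmonom L}]} -> K := mcoeff (mone : {fmonom L}).
have augB (t t' : T) : aug (t - t') = aug t - aug t' by exact: mcoeffB.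
have augD (t t' : T) : aug (t + t') = aug t + aug t' by exact: mcoeffD.
have augZ a (t : T) : aug (a *: t) = a * aug t by exact: mcoeffZ.
have augM (t t' : T) : aug (t * t') = aug t * aug t'.
  rewrite -[t * t']/(free_mul t t') free_mulE.
  exact: (rmorphM (mcoeff (mone : {fmonom L}))).
have aug_gen x : aug (fgen x) = 0 by rewrite /aug mcoeffU1 fm1_eq1.
have aug1 : aug 1 = 1 by exact: (rmorph1 (mcoeff (mone : {fmonom L}))).
have aug0 : aug 0 = 0 by exact: mcoeff0.
move: aug => aug in augB augD augZ augM aug_gen aug1 aug0 *.
apply/eqP; rewrite /env_one -(raddf0 pi) => /lproj_eq; rewrite subr0 => I1.
suff /(_ 1 I1) : I `<=` [set t : T | aug t = 0].
  by rewrite /= aug1 => /eqP; rewrite oner_eq0.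
apply: lspan_min => [|_ [a [r [b [Rr ->]]]]].
  by split=> [|a u v /= u0 v0]; rewrite /= ?aug0 // augD augZ u0 v0 mulr0 addr0.
rewrite /= !augM; suff -> : aug r = 0 by rewrite mulr0 mul0r.
case: Rr => [c x y|x y]; first by rewrite augB augD augZ !aug_gen mulr0 addr0 subr0.
by rewrite !augB !augM !aug_gen mulr0 !subr0.
Qed.

HB.instance Definition _ := GRing.Zmodule_isNzRing.Build envel
  env_mulA env_mul1l env_mul1r env_mulDl env_mulDr env_one_neq0.

Lemma env_projM s t : pi (s * t) = (pi s : envel) * pi t.
Proof. by rewrite -env_mulE. Qed.

Fact env_scaleAl (a : K) (u v : envel) : a *: (u * v) = (a *: u) * v.
Proof.
rewrite -(lreprK u) -(lreprK v) -env_projM -![a *: pi _]linearZ -env_projM.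
by rewrite scalerAl.
Qed.
HB.instance Definition _ :=
  GRing.Lmodule_isLalgebra.Build K envel env_scaleAl.
Fact env_scaleAr (a : K) (u v : envel) : a *: (u * v) = u * (a *: v).
Proof.
rewrite -(lreprK u) -(lreprK v) -env_projM -![a *: pi _]linearZ -env_projM.
by rewrite scalerAr.
Qed.
HB.instance Definition _ :=
  GRing.Lalgebra_isAlgebra.Build K envel env_scaleAr.

Definition env_in (x : L) : envel := pi (fgen x).
End Enveloping.

Section InducedModule.
Variables (K : fieldType) (L : lieAlgType K).

(* [chi x a] means: x belongs to the subalgebra p of L and acts on the
   one-dimensional p-module K by the scalar a.  The tensor product
   U(L) (x)_{U(p)} K is U(L) (x)_K K = U(L) modulo the balancing relations
   u x (x) 1 = u (x) a, which need only be imposed for x in p since p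
   generates U(p). *)
Variable chi : L -> K -> Prop.

Definition balancing : set (envel L) :=
  [set t | exists u x a, chi x a /\ t = u * env_in x - a *: u].

Definition induced : Type := lquot balancing.
HB.instance Definition _ := GRing.Lmodule.on induced.

Definition ind_gen : induced := lproj balancing 1.

Definition ind_act : envel L -> induced -> induced :=
  locked_with lquot_key (fun u m => lproj balancing (u * lrepr m)).

Lemma ind_actE u w : ind_act u (lproj balancing w) = lproj balancing (u * w).
Proof.
rewrite /ind_act locked_withE; apply/lproj_eq; rewrite -mulrBr; move: (@lproj_repr K (envel L) balancing w).
set t := (_ - w); move: t; apply: lspan_min => [|_ [u' [x [a [xa ->]]]]].
  split=> [|a t t' It It'] /=.
    by rewrite mulr0; exact: (lspan_subspace _).1.
  rewrite mulrDr -scalerAr.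
  by apply: (lspan_subspace _).2; [exact: It | exact: It'].
apply: sub_lspan; exists (u * u'), x, a; split=> //.
by rewrite mulrBr mulrA -scalerAr.
Qed.

Lemma ind_actM u w m : ind_act (u * w) m = ind_act u (ind_act w m).
Proof. by rewrite -(lreprK m) !ind_actE mulrA. Qed.

Lemma ind_act1 m : ind_act 1 m = m.
Proof. by rewrite -(lreprK m) ind_actE mul1r. Qed.
End InducedModule.

Section So7.
Variable K : numClosedFieldType.

(* The basis vector e_k (k = 1, 2, 3, 0, -1, -2, -3) has position [pos k] in
   the ordered basis e_1, e_2, e_3, e_0, e_{-1}, e_{-2}, e_{-3}. *)
Definition pos (k : int) : 'I_7 :=
  inZp (match k with
        | Posz 0 => 3
        | Posz n.+1 => n
        | Negz n => n + 4
        end)%N.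

(* The involution of positions induced by e_k |-> e_{-k}. *)
Definition negp (i : 'I_7) : 'I_7 :=
  inZp (if (i < 3)%N then i + 4 else if i == 3 :> nat then 3 else i - 4)%N.

Lemma negpK : involutive negp.
Proof. by move=> i; apply/val_inj; case: i => [[|[|[|[|[|[|[|//]]]]]]]]. Qed.

Lemma negp_pos (k : int) : (`|k| <= 3)%N -> negp (pos k) = pos (- k).
Proof.
by case: k => [[|[|[|[|//]]]]|[|[|[|//]]]] _; apply/val_inj.
Qed.

Definition gramB : 'M[K]_7 := \matrix_(i, j) (i == negp j)%:R.
Definition formB (v w : 'cV[K]_7) : K := (v^T *m gramB *m w) 0 0.

Definition skewB : {pred 'M[K]_7} :=
  fun X => `[< forall v w, formB (X *m v) w = - formB v (X *m w) >].

Lemma formBE v w : formB v w = \sum_i v (negp i) 0 * w i 0.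
Proof.
rewrite /formB mxE; apply: eq_bigr => i _; congr (_ * _).
rewrite mxE (bigD1 (negp i)) //= !mxE eqxx mulr1 big1 ?addr0 // => j ji.
by rewrite !mxE (negPf ji) mulr0.
Qed.

Lemma formB_linearl a v v' w :
  formB (a *: v + v') w = a * formB v w + formB v' w.
Proof.
rewrite !formBE mulr_sumr -big_split; apply: eq_bigr => i _.
by rewrite !mxE mulrDl mulrA.
Qed.

Lemma formB_linearr a v w w' :
  formB v (a *: w + w') = a * formB v w + formB v w'.
Proof.
rewrite !formBE mulr_sumr -big_split; apply: eq_bigr => i _.
by rewrite !mxE mulrDr mulrCA.
Qed.

Lemma skewB_submod_closed : submod_closed skewB.
Proof.
split=> [|a X Y /asboolP sX /asboolP sY]; apply/asboolP => v w.
  by rewrite /formB !mul0mx mulmx0 trmx0 !mul0mx mxE oppr0.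
rewrite !mulmxDl -!scalemxAl formB_linearl formB_linearr sX sY.
by rewrite opprD mulrN.
Qed.
HB.instance Definition _ :=
  GRing.isSubmodClosed.Build K 'M[K]_7 skewB skewB_submod_closed.

Record so7 : predArgType := So7 { so7_mx :> 'M[K]_7; _ : so7_mx \in skewB }.
HB.instance Definition _ := [isSub for so7_mx].
HB.instance Definition _ := [Choice of so7 by <:].
HB.instance Definition _ := [SubChoice_isSubLmodule of so7 by <:].

Lemma skewB_lie (X Y : so7) : X *m Y - Y *m X \in skewB.
Proof.
case: X Y => [X /= /asboolP sX] [Y /= /asboolP sY]; apply/asboolP => v w.
rewrite !mulmxBl -!mulmxA.
have subE (u u' : 'cV[K]_7) : u - u' = -1 *: u' + u.
  by rewrite scaleN1r addrC.
rewrite !subE formB_linearl formB_linearr.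
by rewrite !(sX, sY) !opprK; ring.
Qed.

Definition so7_lie (X Y : so7) : so7 := So7 (skewB_lie X Y).

Fact so7_lie_linearl Y : linear (so7_lie^~ Y).
Proof.
move=> a X X'; apply/val_inj => /=.
rewrite mulmxDl mulmxDr -scalemxAl -scalemxAr scalerBr opprD.
by rewrite addrACA.
Qed.
Fact so7_lie_linearr X : linear (so7_lie X).
Proof.
move=> a Y Y'; apply/val_inj => /=.
rewrite mulmxDl mulmxDr -scalemxAl -scalemxAr scalerBr opprD.
by rewrite addrACA.
Qed.
Fact so7_liexx X : so7_lie X X = 0.
Proof. by apply/val_inj; rewrite /= subrr. Qed.
Fact so7_jacobi X Y Z :
  so7_lie X (so7_lie Y Z) + so7_lie Y (so7_lie Z X)
    + so7_lie Z (so7_lie X Y) = 0.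
Proof.
apply/val_inj => /=; rewrite !mulmxBl !mulmxBr !mulmxA.
apply/matrixP => i j; rewrite !mxE; ring.
Qed.
HB.instance Definition _ := Lmodule_isLieAlgebra.Build K so7
  so7_lie_linearl so7_lie_linearr so7_liexx so7_jacobi.

(* The endomorphism e_a (x) e_b^* - e_{-b} (x) e_{-a}^*; all the root vectors
   and the h_{eps_i} are multiples of such elements. *)
Definition skew_unit_mx (a b : 'I_7) : 'M[K]_7 :=
  delta_mx a b - delta_mx (negp b) (negp a).

Lemma skew_unit_skewB a b : skew_unit_mx a b \in skewB.
Proof.
have deltaE (c d i : 'I_7) (u : 'cV[K]_7) :
    (delta_mx c d *m u) i 0 = (i == c)%:R * u d 0.
  rewrite mxE (bigD1 d) //= !mxE eqxx andbT big1 ?addr0 // => j jd.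
  by rewrite !mxE (negPf jd) andbF mul0r.
have formBl (c d : 'I_7) (v w : 'cV[K]_7) :
    formB (delta_mx c d *m v) w = v d 0 * w (negp c) 0.
  rewrite formBE (bigD1 (negp c)) //= deltaE negpK eqxx mul1r big1 ?addr0 //.
  by move=> i ic; rewrite deltaE -(inj_eq (can_inj negpK)) negpK (negPf ic) !mul0r.
have formBr (c d : 'I_7) (v w : 'cV[K]_7) :
    formB v (delta_mx c d *m w) = v (negp c) 0 * w d 0.
  rewrite formBE (bigD1 c) //= deltaE eqxx mul1r big1 ?addr0 // => i ic.
  by rewrite deltaE (negPf ic) mul0r mulr0.
have subE (u u' : 'cV[K]_7) : u - u' = -1 *: u' + u.
  by rewrite scaleN1r addrC.
apply/asboolP => v w; rewrite /skew_unit_mx !mulmxBl !subE.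
rewrite formB_linearl formB_linearr !formBl !formBr !negpK; ring.
Qed.

Definition skew_unit (a b : int) : so7 := So7 (skew_unit_skewB (pos a) (pos b)).

(* h_{eps_i}, and the root vectors: for i <> j in {1, 2, 3},
   [gsub i j] has root eps_i - eps_j and, for i < j, [gadd i j] and [gaddN i j]
   have roots eps_i + eps_j and - (eps_i + eps_j), while [gshort i] and
   [gshortN i] have roots eps_i and - eps_i. *)
Definition hcart (i : int) : so7 := skew_unit i i.
Definition gsub (i j : int) : so7 := skew_unit i j.
Definition gadd (i j : int) : so7 := skew_unit i (- j).
Definition gaddN (i j : int) : so7 := skew_unit (- j) i.
Definition gshort (i : int) : so7 := sqrtC 2 *: skew_unit i 0.
Definition gshortN (i : int) : so7 := sqrtC 2 *: skew_unit 0 i.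

Definition cartan : set so7 :=
  lspan [set x | x \in [:: hcart 1; hcart 2; hcart 3]].

(* eps_i reads off the coefficient of h_{eps_i}; only its restriction to
   [cartan] is meaningful. *)
Definition eps (i : int) (x : so7) : K := so7_mx x (pos i) (pos i).

Definition levi : set so7 :=
  lspan [set x | cartan x \/
    x \in [:: gadd 2 3; gaddN 2 3; gsub 2 3; gsub 3 2;
              gshort 2; gshortN 2; gshort 3; gshortN 3]].

Definition nilrad : set so7 :=
  lspan [set x | x \in [:: gshort 1; gadd 1 2; gsub 1 2; gadd 1 3; gsub 1 3]].

Definition nilradN : set so7 :=
  lspan [set x | x \in [:: gshortN 1; gaddN 1 2; gsub 2 1; gaddN 1 3; gsub 3 1]].

(* An element of p = l + n is h + y + n with h in [cartan], y in [l, l] and n in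
   the nilradical; it acts on C_lambda by lambda eps_1(h). *)
Inductive Clambda (lam : K) : so7 -> K -> Prop :=
  ClambdaAct h y n : cartan h -> derived levi y -> nilrad n ->
    Clambda lam (h + y + n) (lam * eps 1 h).

Definition g2_gens : set so7 :=
  [set x | x \in [:: gsub 2 3; gsub 3 2;
                     gsub 1 2 + gshort 3; gsub 2 1 + gshortN 3]].

(* i(Lie G_2) and i(h'). *)
Definition g2 : set so7 := lie_gen g2_gens.
Definition g2_cartan : set so7 := g2 `&` cartan.

(* The simple roots of G_2 as functionals on i(h'): the weights of
   [gsub 1 2 + gshort 3] (on i(h'), eps_1 - eps_2 = eps_3) and [gsub 2 3]. *)
Definition alpha1 (h : so7) : K := eps 1 h - eps 2 h.
Definition alpha2 (h : so7) : K := eps 2 h - eps 3 h.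

(* The root space of i(Lie G_2) for the functional a alpha_1 + b alpha_2. *)
Definition g2_root_space (a b : nat) : set so7 :=
  [set x | g2 x /\ forall h, g2_cartan h ->
             lie h x = (a%:R * alpha1 h + b%:R * alpha2 h) *: x].

Definition g2_positive_root (a b : nat) : Prop :=
  (a, b) <> (0, 0)%N /\ exists2 x, g2_root_space a b x & x <> 0.

(* i(n') and i([l', l']); the pair (0, 1) is the root alpha_2. *)
Definition g2_nilrad : set so7 :=
  lspan [set x | exists a b, [/\ g2_positive_root a b, (a, b) <> (0, 1)%N
                                & g2_root_space a b x]].
Definition g2_levi_ss : set so7 :=
  lspan [set x | x \in [:: gsub 2 3; gsub 3 2; hcart 2 - hcart 3]].

(* The subspace S^d(n_-) of U(n_-) = S(n_-), seen inside U(so(7)). *)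
Definition sym_nilradN (d : nat) : set (envel so7) :=
  lspan [set q | exists2 y : 'I_d -> so7, (forall i, nilradN (y i)) &
                 q = \prod_(i < d) env_in (y i)].

Definition u1 : envel so7 :=
  env_in (gsub 2 1) * env_in (gaddN 1 2) + env_in (gaddN 1 3) * env_in (gsub 3 1).
Definition u2 : envel so7 := env_in (gshortN 1) ^+ 2.

Section Verma.
Variable lam : K.

Definition verma : lmodType K := induced (Clambda lam).
Definition verma_hw : verma := ind_gen (Clambda lam).
Definition verma_act (q : envel so7) (v : verma) : verma := ind_act q v.

Definition homogeneity (d : nat) (v : verma) : Prop :=
  exists2 q, sym_nilradN d q & v = verma_act q verma_hw.

Definition weight_vector (A : set so7) (v : verma) : Prop :=
  exists mu : {scalar so7}, forall h, A h -> verma_act (env_in h) v = mu h *: v.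

Definition annihilated_by (A : set so7) (v : verma) : Prop :=
  forall x, A x -> verma_act (env_in x) v = 0.

Definition g2_singular (v : verma) : Prop :=
  [/\ v <> 0, weight_vector g2_cartan v, annihilated_by g2_nilrad v
    & annihilated_by g2_levi_ss v].

Definition so7_singular (v : verma) : Prop :=
  [/\ v <> 0, weight_vector cartan v, annihilated_by nilrad v
    & annihilated_by (derived levi) v].
End Verma.
End So7.

Arguments u1 {K}.
Arguments u2 {K}.
Arguments verma_hw {K}.
Arguments verma_act {K} lam q v.

Definition Cplx (R : realType) : numClosedFieldType := R[i].

(* Main.v *)
(* S(n_-) is the polynomial ring in five variables, and M_lambda is identified with it,
   so(7) acting by differential operators [rho]: n_- by multiplication, the Levi factor by
   vector fields (shifted by lambda), and n by the second order operators
   (lambda - E) d_a + x_{-a} Delta / 2, where E is the Euler field and Delta the Laplacian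
   of the invariant quadric Q = sum_a x_a x_{-a}; here 4 u_1 + u_2 acts as 2 Q.
   A homogeneous polynomial killed by g_{eps_2 - eps_3}, h_{eps_2} - h_{eps_3} and
   g_{eps_3} is so(5)-invariant, so it is a multiple of Q^N, and
   g_{eps_1 - eps_2} Q^N = 2 N (lambda - N + 5/2) x_{-2} Q^(N-1) then fixes lambda.
   A homogeneous G_2-singular vector is killed by g_{eps_1 - eps_2} + g_{eps_3}, hence by
   both summands, as they change the degree differently. *)
Require Import Defs.
From HB Require Import structures.
From mathcomp Require Import all_boot all_order all_algebra finmap.
From mathcomp Require Import boolp classical_sets reals complex.
From mathcomp Require monalg.
From mathcomp Require Import mpoly ring.
Set Implicit Arguments.
Unset Strict Implicit.
Unset Printing Implicit Defensive.
Import GRing.Theory Num.Theory.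
Local Open Scope ring_scope.

(** No PBW theorem is invoked. Evaluating polynomials at the commuting elements of n_- gives a map
    onto M_lambda; its injectivity comes from the universal property of the induced module, once
    [rho] is known to be a representation. That verification is the computational core. So few
    equations force so(5)-invariance because degree d polynomials are the sum of the Q^j H_(d-2j),
    where the harmonic H_k is irreducible of highest weight k eps_2. Since g_{eps_2 - eps_3} and
    g_{eps_3} are the simple root vectors of so(5), they leave only combinations of the Q^j
    x_2^(d-2j), on which h_{eps_2} - h_{eps_3} has eigenvalue d - 2j. Recursions on coefficients
    replace this theory below. i(Lie G_2) is given by generators and n' by root spaces. The
    stabiliser of an invariant 3-form bounds i(Lie G_2) from above and yields eps_1 = eps_2 + eps_3
    on i(h'), which puts g_{eps_1 - eps_2} + g_{eps_3} into n'. That n' kills the constant 1 follows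
    from a grading element of i(h') whose largest eigenvalue on V is at e_1, so the roots of G_2 are
    never listed. *)

Section LinearFor.
Context (K : fieldType) (U V : lmodType K) (f : U -> V).
Hypothesis f_linear : linear f.

Lemma lin0 : f 0 = 0.
Proof. by have := f_linear (-1) 0 0; rewrite scaleN1r addNr scaleN1r addNr. Qed.

Lemma linZ a u : f (a *: u) = a *: f u.
Proof. by rewrite -[a *: u]addr0 f_linear lin0 addr0. Qed.

Lemma linD u v : f (u + v) = f u + f v.
Proof. by have := f_linear 1 u v; rewrite !scale1r. Qed.

Lemma linB u v : f (u - v) = f u - f v.
Proof. by rewrite addrC -scaleN1r f_linear scaleN1r addrC. Qed.

Lemma linN u : f (- u) = - f u.
Proof. by rewrite -scaleN1r linZ scaleN1r. Qed.

Lemma lin_sum (I : Type) (r : seq I) (F : I -> U) :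
  f (\sum_(i <- r) F i) = \sum_(i <- r) f (F i).
Proof. by elim/big_rec2: _ => [|i y z _ <-]; [exact: lin0 | exact: linD]. Qed.
End LinearFor.

Section LinearClosure.
Context (K : fieldType) (U V : lmodType K).

Lemma islin_add (f g : U -> V) :
  linear f -> linear g -> linear (fun u => f u + g u).
Proof. by move=> fl gl a u v; rewrite fl gl scalerDr addrACA. Qed.

Lemma islin_scale c (f : U -> V) : linear f -> linear (fun u => c *: f u).
Proof. by move=> fl a u v; rewrite fl scalerDr !scalerA mulrC. Qed.

Lemma islin_sum (I : Type) (r : seq I) (F : I -> U -> V) :
  (forall i, linear (F i)) -> linear (fun u => \sum_(i <- r) F i u).
Proof.
move=> Fl a u v; rewrite scaler_sumr -big_split /=.
by apply: eq_bigr => i _; rewrite Fl.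
Qed.
End LinearClosure.

Lemma subspaceZ (K : fieldType) (V : lmodType K) (W : set V) a u :
  subspace W -> W u -> W (a *: u).
Proof. by move=> [W0 WD] Wu; rewrite -[_ *: u]addr0; apply: WD. Qed.

Lemma subspaceN (K : fieldType) (V : lmodType K) (W : set V) u :
  subspace W -> W u -> W (- u).
Proof. by move=> sW Wu; rewrite -scaleN1r; exact: subspaceZ. Qed.

Lemma subspaceD (K : fieldType) (V : lmodType K) (W : set V) u v :
  subspace W -> W u -> W v -> W (u + v).
Proof. by move=> [W0 WD] Wu Wv; rewrite -[u]scale1r; exact: WD. Qed.

Lemma subspace_sum (K : fieldType) (V : lmodType K) (W : set V) (I : Type)
    (r : seq I) (F : I -> V) :
  subspace W -> (forall i, W (F i)) -> W (\sum_(i <- r) F i).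
Proof.
move=> sW WF; elim/big_rec: _ => [|i u _ Wu]; first exact: sW.1.
exact: subspaceD.
Qed.

(** * The induced module *)

Section InducedModule.
Context (K : fieldType) (L : lieAlgType K).

Section FreeAction.
Import monalg.
Context (P : lmodType K) (rho : L -> P -> P).
Hypothesis rho_linear : forall x, linear (rho x).

Definition word_act (w : seq L) (f : P) : P := foldr rho f w.

Definition free_act (t : free_alg L) (f : P) : P :=
  \sum_(w <- msupp (t : {malg K[{fmonom L}]})) mcoeff w t *: word_act w f.

Lemma word_act_linear w : linear (word_act w).
Proof.
elim: w => //= x w IH a f g.
by rewrite -[LHS]/(rho x (word_act w _)) IH rho_linear.
Qed.

(** Elements with different supports can only be compared over a common finite set of words; this is
    what makes [free_act] additive in its first argument. *)
Lemma free_actEw (d : {fset {fmonom L}}) (t : free_alg L) f :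
  (msupp (t : {malg K[{fmonom L}]}) `<=` d)%fset ->
  free_act t f = \sum_(w <- d) mcoeff w t *: word_act w f.
Proof.
move=> le; rewrite /free_act (big_fset_incl _ le) //= => w _ /mcoeff_outdom ->.
by rewrite scale0r.
Qed.

Lemma free_act_linearl f : linear (free_act^~ f).
Proof.
move=> a s t.
pose d := (msupp (s : {malg K[{fmonom L}]}) `|` msupp (t : {malg K[{fmonom L}]}))%fset.
have le : (msupp (a *: s + t : {malg K[{fmonom L}]}) `<=` d)%fset.
  by apply: (fsubset_trans (msuppD_le _ _)); apply: fsetSU; apply: msuppZ_le.
rewrite (free_actEw f le) (free_actEw f (fsubsetUl _ _ : _ `<=` d)%fset).
rewrite (free_actEw f (fsubsetUr _ _ : _ `<=` d)%fset) scaler_sumr -big_split /=.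
by apply: eq_bigr => w _; rewrite mcoeffD mcoeffZ scalerDl scalerA.
Qed.

Lemma free_act_linearr t : linear (free_act t).
Proof.
move=> a f g; rewrite /free_act scaler_sumr -big_split /=.
apply: eq_bigr => w _; rewrite word_act_linear scalerDr !scalerA.
by rewrite mulrC.
Qed.

Lemma free_actU c (w : {fmonom L}) f :
  free_act (<< c *g w >> : {malg K[{fmonom L}]}) f = c *: word_act w f.
Proof. by rewrite (free_actEw _ msuppU_le) big_seq_fset1 mcoeffUU. Qed.

Lemma free_act1 f : free_act 1 f = f.
Proof.
by rewrite -[1]/(<< mone : {fmonom L} >> : {malg K[{fmonom L}]}) free_actU scale1r fm1.
Qed.

Lemma free_act_gen x f : free_act (fgen x) f = rho x f.
Proof. by rewrite free_actU scale1r fmuE. Qed.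

Lemma word_actM (w w' : {fmonom L}) f :
  word_act (fmmul w w') f = word_act w (word_act w' f).
Proof. by rewrite fmmulE /word_act foldr_cat. Qed.

Lemma free_actM s t f : free_act (s * t) f = free_act s (free_act t f).
Proof.
rewrite -[s * t]/(free_mul s t) free_mulE malgM_def fgmulEl1.
rewrite (lin_sum (free_act_linearl f)); apply: eq_bigr => w _.
rewrite fgmulUg (lin_sum (free_act_linearl f)).
rewrite (lin_sum (word_act_linear w)) scaler_sumr; apply: eq_bigr => w' _.
by rewrite free_actU (word_actM w w') (linZ (word_act_linear w)) scalerA.
Qed.

Hypothesis rho_linearl : forall f, linear (rho^~ f).
Hypothesis rho_lie :
  forall x y f, rho (lie x y) f = rho x (rho y f) - rho y (rho x f).

(** In a product a r b the middle factor already acts by zero: for a linearity relation because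
    [rho] is linear in the Lie algebra element, for a bracket relation because of [rho_lie]. *)
Lemma free_act_ideal t f : lspan (@env_ideal_gen K L) t -> free_act t f = 0.
Proof.
move=> It; suff /(_ t It) :
    (lspan (@env_ideal_gen K L) `<=` [set t | forall f, free_act t f = 0])%classic.
  exact.
apply: lspan_min => [|_ [a [r [b [Rr ->]]]] g].
  split=> [g|a u v u0 v0 g] /=; first exact: lin0 (free_act_linearl g).
  by rewrite free_act_linearl u0 v0 scaler0 addr0.
rewrite !free_actM; set h := free_act b g.
have -> : free_act r h = 0.
  case: Rr => [c x y|x y].
    by rewrite (linB (free_act_linearl h)) free_act_linearl !free_act_gen rho_linearl subrr.
  by rewrite !(linB (free_act_linearl h)) !free_actM !free_act_gen rho_lie subrr.
exact: lin0 (free_act_linearr a).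
Qed.

(** Frobenius reciprocity. The action of the free algebra descends to U(L) by [free_act_ideal], and
    evaluation at [p] respects the balancing relations because [p] transforms by [chi]. Every
    representation with such a vector thus gives a morphism out of the induced module. *)
Lemma induced_universal (chi : L -> K -> Prop) (p : P) :
  (forall x a, chi x a -> rho x p = a *: p) ->
  exists Phi : induced chi -> P,
    [/\ linear Phi, Phi (ind_gen chi) = p &
        forall x m, Phi (ind_act (env_in x) m) = rho x (Phi m)].
Proof.
move=> chi_p.
pose act (u : envel L) (f : P) := free_act (lrepr u) f.
have actE t f : act (lproj _ t) f = free_act t f.
  apply/eqP; rewrite -subr_eq0 -(linB (free_act_linearl f)); apply/eqP.
  by apply: free_act_ideal; exact: lproj_repr.
have act_lin f : linear (act^~ f).
  move=> a u v; rewrite /act -free_act_linearl -[RHS]actE; congr act.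
  by rewrite -{1}(lreprK u) -{1}(lreprK v) -linearP.
have actM u v f : act (u * v) f = act u (act v f).
  by rewrite -(lreprK u) -(lreprK v) -env_projM !actE free_actM.
have act1 f : act 1 f = f by rewrite actE free_act1.
have act_in x f : act (env_in x) f = rho x f by rewrite actE free_act_gen.
have bal u : lspan (balancing chi) u -> act u p = 0.
  move: u; apply: lspan_min => [|_ [u [x [a [xa ->]]]]] /=.
    by split=> [|a u v u0 v0] /=; rewrite ?(lin0 (act_lin p)) // act_lin u0 v0 scaler0 addr0.
  rewrite (linB (act_lin p)) actM act_in (chi_p _ _ xa) (linZ (act_lin p)).
  by rewrite [act u _](linZ (free_act_linearr _)) subrr.
pose Phi (m : induced chi) := act (lrepr m) p.
have PhiE u : Phi (lproj _ u) = act u p.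
  apply/eqP; rewrite -subr_eq0 -(linB (act_lin p)); apply/eqP.
  by apply: bal; exact: lproj_repr.
exists Phi; split.
- move=> a u v; rewrite /Phi -act_lin -[RHS]PhiE; congr Phi.
  by rewrite -{1}(lreprK u) -{1}(lreprK v) -linearP.
- by rewrite PhiE act1.
- by move=> x m; rewrite -{1}(lreprK m) ind_actE PhiE actM act_in.
Qed.
End FreeAction.

Lemma env_in_linear : linear (@env_in K L).
Proof.
move=> a x y; rewrite /env_in -linearP /=; apply/lproj_eq; apply: sub_lspan.
by exists 1, (fgen (a *: x + y) - (a *: fgen x + fgen y)), 1; split;
  [exact: EnvLin | rewrite mul1r mulr1].
Qed.

Lemma env_in_lie (x y : L) :
  env_in (lie x y) = env_in x * env_in y - env_in y * env_in x.
Proof.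
rewrite /env_in -!env_projM -raddfB; apply/lproj_eq; apply: sub_lspan.
exists 1, (fgen (lie x y) - (fgen x * fgen y - fgen y * fgen x)), 1.
by split; [exact: EnvLie | rewrite mul1r mulr1].
Qed.

Section Act.
Variable chi : L -> K -> Prop.

Lemma ind_act_linearl m : linear ((@ind_act K L chi)^~ m).
Proof.
by move=> a u v; rewrite -(lreprK m) !ind_actE mulrDl -scalerAl linearP.
Qed.

Lemma ind_act_linearr u : linear (@ind_act K L chi u).
Proof.
move=> a m n; rewrite -(lreprK m) -(lreprK n) -linearP !ind_actE -linearP.
by rewrite mulrDr -scalerAr.
Qed.

Lemma ind_gen_act x a : chi x a ->
  ind_act (env_in x) (ind_gen chi) = a *: ind_gen chi.
Proof.
move=> xa; rewrite /ind_gen ind_actE mulr1 -linearZ; apply/lproj_eq.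
by apply: sub_lspan; exists 1, x, a; split=> //; rewrite mul1r.
Qed.

Section Spanning.
Import monalg.

(** The generator is cyclic: U(L) is spanned by words in L, and a word acts letter by letter. *)
Lemma induced_ind (W : set (induced chi)) :
  subspace W -> W (ind_gen chi) ->
  (forall x m, W m -> W (ind_act (env_in x) m)) -> forall m, W m.
Proof.
move=> sW Wg Wx m; rewrite -(lreprK m) -[lrepr m]mulr1 -ind_actE -/(ind_gen _).
(* The element is lifted twice, from the module to U(L) and from U(L) to the free algebra, where
   words are available. *)
rewrite -(lreprK (lrepr m)); move: (lrepr (lrepr m)) => t.
have -> : ind_act (lproj (@env_ideal_gen K L) t) (ind_gen chi) =
  \sum_(w <- msupp (t : {malg K[{fmonom L}]}))
    mcoeff w t *: ind_act (lproj _ (<<w>> : {malg K[{fmonom L}]})) (ind_gen chi).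
  rewrite {1}[t](monalgE (t : {malg K[{fmonom L}]})).
  rewrite (raddf_sum (@lproj _ _ _)) /ind_gen ind_actE mulr1.
  rewrite (raddf_sum (@lproj _ _ _)); apply: eq_bigr => w _.
  rewrite ind_actE mulr1 -!linearZ; congr (lproj _ (lproj _ _)).
  by apply/malgP => k; rewrite mcoeffZ !mcoeffU mulrnAr mulr1.
apply: (subspace_sum _ sW) => w; apply: (subspaceZ _ sW); case: w => s.
elim: s => [|x s IH].
  have -> : << FMonom [::] >> = 1 :> free_alg L by rewrite -fmoneE.
  by rewrite ind_act1.
have -> : << FMonom (x :: s) >> =
    fgen x * (<< FMonom s >> : {malg K[{fmonom L}]}) :> free_alg L.
  rewrite -[RHS]/(free_mul _ _) free_mulE malgM_def /fgen fgmulUU mulr1.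
  by congr (<< _ >>); rewrite -[RHS]/(fmmul (fmu x) (FMonom s)) fmmulE fmuE.
by rewrite env_projM ind_actM; apply: Wx.
Qed.
End Spanning.
End Act.
End InducedModule.

(** * The polynomial model of M_lambda *)

(* The positions of e_2, e_3, e_0, e_{-2}, e_{-3} among the basis vectors of V,
   and the involution e_k |-> e_{-k} on them. *)
Definition mid (a : 'I_5) : 'I_7 := inZp (if (a < 3)%N then a.+1 else a.+2).
Definition opp5 (a : 'I_5) : 'I_5 :=
  inZp (if (a < 2)%N then a + 3 else if a == 2 :> nat then 2 else a - 3)%N.

Lemma opp5K : involutive opp5.
Proof. by move=> i; apply/val_inj; case: i => [[|[|[|[|[|//]]]]]]. Qed.

Lemma negp_mid a : negp (mid a) = mid (opp5 a).
Proof. by apply/val_inj; case: a => [[|[|[|[|[|//]]]]]]. Qed.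

Lemma mid_eq a b : (mid a == mid b) = (a == b).
Proof.
by case: a b => [[|[|[|[|[|//]]]]] ?] [[|[|[|[|[|//]]]]] ?]; rewrite -!val_eqE.
Qed.

Lemma mid_eq0 a : (mid a == 0) = false.
Proof. by case: a => [[|[|[|[|[|//]]]]] ?]; rewrite -!val_eqE. Qed.

Lemma mid_eq4 a : (mid a == negp 0) = false.
Proof. by case: a => [[|[|[|[|[|//]]]]] ?]; rewrite -!val_eqE. Qed.

Lemma sum_mid (V : nmodType) (F : 'I_7 -> V) :
  \sum_i F i = F 0 + F (negp 0) + \sum_(a < 5) F (mid a).
Proof.
pose G n := F (inord n).
have E i : F i = G (val i) by rewrite /G inord_val.
rewrite (eq_bigr (fun i : 'I_7 => G (val i))) //.
rewrite [X in _ = _ + X](eq_bigr (fun i => G (val (mid i)))) //.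
rewrite !E !big_ord_recl !big_ord0 /= !addr0 -!addrA; congr (_ + _).
by do 3![rewrite [RHS]addrCA; congr (_ + _)].
Qed.

Section Model.
Context (K : numClosedFieldType) (lam : K).
Implicit Types x y z : so7 K.

(** Skewness tested on the pair e_j, e_{-i}. It makes the row and column of e_{-1} redundant, which
    is why [rho_def] reads only entries indexed by e_1 and the five middle vectors. *)
Lemma so7_entry x i j : x i j = - x (negp j) (negp i).
Proof.
case: x => [m /= /asboolP sk].
pose e i : 'cV[K]_7 := delta_mx i 0.
have me k l : (m *m e k) l 0 = m l k by rewrite -colE mxE.
have ee k l : e k l 0 = (l == k)%:R by rewrite mxE eqxx andbT.
have := sk (e j) (e (negp i)); rewrite !formBE.
under eq_bigr do rewrite me ee.
under [X in - X]eq_bigr do rewrite me ee.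
rewrite (bigD1 (negp i)) //= eqxx mulr1 negpK big1 ?addr0; last first.
  by move=> k /negPf ->; rewrite mulr0.
rewrite (bigD1 (negp j)) //= negpK eqxx mul1r big1 ?addr0 // => k kj.
by rewrite -(inj_eq (can_inj negpK)) in kj; rewrite negpK in kj; rewrite (negPf kj) mul0r.
Qed.

Lemma so7_entry_anti x i : x i (negp i) = 0.
Proof.
have /eqP := so7_entry x i (negp i); rewrite negpK -addr_eq0 -mulr2n.
by rewrite mulrn_eq0 /= => /eqP.
Qed.

Lemma so7_entry04 x : x 0 (negp 0) = 0. Proof. exact: so7_entry_anti. Qed.

Lemma so7_entry40 x : x (negp 0) 0 = 0.
Proof. by have := so7_entry_anti x (negp 0); rewrite negpK. Qed.

Lemma so7_lieE x y i j :
  lie x y i j = \sum_k x i k * y k j - \sum_k y i k * x k j.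
Proof. by rewrite /= !mxE. Qed.

Lemma so7_DE x y i j : (x + y : so7 K) i j = x i j + y i j.
Proof. by rewrite mxE. Qed.

Lemma so7_ZE (a : K) x i j : (a *: x : so7 K) i j = a * x i j.
Proof. by rewrite mxE. Qed.

(** A basis of n_- free of the factor sqrt 2 carried by g_{-eps_1}; in the model [lower b] is
    multiplication by 'X_b. *)
Definition lower (b : 'I_5) : so7 K := So7 (@skew_unit_skewB K (mid b) 0).

Lemma lie_lowerE x b i j : lie x (lower b) i j =
  x i (mid b) * (j == 0)%:R - x i (negp 0) * (j == mid (opp5 b))%:R
  - (i == mid b)%:R * x 0 j + (i == negp 0)%:R * x (mid (opp5 b)) j.
Proof.
rewrite so7_lieE.
have l k : lower b k j =
    (k == mid b)%:R * (j == 0)%:R - (k == negp 0)%:R * (j == mid (opp5 b))%:R.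
  by rewrite /= !mxE negp_mid -!natrM !mulnb.
have r k : lower b i k =
    (i == mid b)%:R * (k == 0)%:R - (i == negp 0)%:R * (k == mid (opp5 b))%:R.
  by rewrite /= !mxE negp_mid -!natrM !mulnb.
have pickl (F : 'I_7 -> K) k0 c : \sum_k F k * ((k == k0)%:R * c) = F k0 * c.
  rewrite (bigD1 k0) //= eqxx mul1r big1 ?addr0 // => k /negPf ->.
  by rewrite mul0r mulr0.
have pickr (F : 'I_7 -> K) k0 c : \sum_k c * (k == k0)%:R * F k = c * F k0.
  rewrite (bigD1 k0) //= eqxx mulr1 big1 ?addr0 // => k /negPf ->.
  by rewrite mulr0 mul0r.
under eq_bigr do rewrite l mulrBr.
under [X in _ - X]eq_bigr do rewrite r mulrBl.
by rewrite !sumrB !pickl !pickr opprB addrA addrAC.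
Qed.

Lemma lie_lower00 x b : lie x (lower b) 0 0 = x 0 (mid b).
Proof.
rewrite lie_lowerE !eqxx mulr1 ![0 == mid _]eq_sym !mid_eq0 mulr0 mul0r !subr0.
by rewrite mul0r addr0.
Qed.

Lemma lie_lower_mid0 x b a :
  lie x (lower b) (mid a) 0 = x (mid a) (mid b) - (a == b)%:R * x 0 0.
Proof.
rewrite lie_lowerE eqxx mulr1 [0 == mid _]eq_sym mid_eq0 mulr0 subr0 mid_eq.
by rewrite mid_eq4 mul0r addr0.
Qed.

Lemma lie_lower0_mid x b a : lie x (lower b) 0 (mid a) = 0.
Proof.
rewrite lie_lowerE mid_eq0 mulr0 so7_entry04 mul0r subrr [0 == mid _]eq_sym.
by rewrite mid_eq0 !mul0r addr0 subrr.
Qed.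

Lemma lie_lower_mid x b a c : lie x (lower b) (mid a) (mid c) =
  x 0 (mid (opp5 a)) * (c == opp5 b)%:R - (a == b)%:R * x 0 (mid c).
Proof.
rewrite lie_lowerE mid_eq0 mulr0 !mid_eq mid_eq4 mul0r addr0 sub0r.
by rewrite (so7_entry x (mid a)) negpK negp_mid mulNr opprK.
Qed.

Local Notation P := {mpoly K[5]}.
Implicit Types f g : P.

Definition euler f : P := \sum_(c < 5) 'X_c * f^`M(c).
Definition lap f : P := \sum_(c < 5) (f^`M(c))^`M(opp5 c).
(** The operator of [sk 0 (mid a)] in n. The factor 1/2 is forced: commuting the Laplacian with 'X_b
    yields twice a derivative, whereas the bracket with [lower b] contains it once. *)
Definition raise (a : 'I_5) f : P :=
  lam *: f^`M(a) - euler f^`M(a) + 2^-1 *: ('X_(opp5 a) * lap f).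

(* Fourier transform of the action of so(7) on functions on the quadric: on the
   nilradical [n] it is by second order operators. *)
Definition rho_def x f : P :=
  \sum_(a < 5) x (mid a) 0 *: ('X_a * f) + x 0 0 *: (lam *: f - euler f)
  + \sum_(a < 5) \sum_(b < 5) x (mid a) (mid b) *: ('X_a * f^`M(b))
  + \sum_(a < 5) x 0 (mid a) *: raise a f.

(* Locked so that [rho x f] is never matched as the sum it unfolds to. *)
Fact rho_key : unit. Proof. by []. Qed.
Definition rho := locked_with rho_key rho_def.
Lemma rhoE : rho = rho_def. Proof. exact: locked_withE. Qed.

Lemma euler_linear : linear euler.
Proof.
move=> a f g; rewrite /euler scaler_sumr -big_split; apply: eq_bigr => c _ /=.
by rewrite linearP mulrDr scalerAr.
Qed.

Lemma lap_linear : linear lap.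
Proof.
move=> a f g; rewrite /lap scaler_sumr -big_split; apply: eq_bigr => c _ /=.
by rewrite !linearP.
Qed.

Lemma raise_linear a : linear (raise a).
Proof.
by move=> k f g; rewrite /raise mderivD mderivZ euler_linear lap_linear -!mul_mpolyC; ring.
Qed.

Lemma rho_linear x : linear (rho x).
Proof.
rewrite rhoE; apply: islin_add; [apply: islin_add; [apply: islin_add|]|].
- by apply: islin_sum => a; apply: islin_scale => k f g; rewrite mulrDr scalerAr.
- apply: islin_scale => k f g; rewrite euler_linear -!mul_mpolyC; ring.
- apply: islin_sum => a; apply: islin_sum => b; apply: islin_scale => k f g.
  by rewrite mderivD mderivZ mulrDr scalerAr.
- by apply: islin_sum => a; apply: islin_scale; exact: raise_linear.
Qed.

Lemma rho_linearl f : linear (rho^~ f).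
Proof.
have lin_entry i j g : linear (fun x : so7 K => x i j *: g).
  by move=> k x y; rewrite so7_DE so7_ZE scalerDl scalerA.
rewrite rhoE; apply: islin_add; [apply: islin_add; [apply: islin_add|]|].
- by apply: islin_sum => a; exact: lin_entry.
- exact: lin_entry.
- by apply: islin_sum => a; apply: islin_sum => b; exact: lin_entry.
- by apply: islin_sum => a; exact: lin_entry.
Qed.

Lemma pick5 (V : lmodType K) (F : 'I_5 -> V) b : \sum_a (a == b)%:R *: F a = F b.
Proof.
by rewrite (bigD1 b) //= eqxx scale1r big1 ?addr0 // => a /negPf ->; rewrite scale0r.
Qed.

Lemma mderiv_mulX a b f : ('X_b * f)^`M(a) = (a == b)%:R *: f + 'X_b * f^`M(a).
Proof.
rewrite mderivM mderivX mnm1E eq_sym; case: eqP => [->|_]; last by rewrite !scale0r mul0r.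
have -> : (U_(b) - U_(b))%MM = 0%MM by apply/mnmP=> i; rewrite mnmBE subnn mnm0E.
by rewrite mpolyX0 !scale1r mul1r.
Qed.

Lemma euler_mulX b f : euler ('X_b * f) = 'X_b * f + 'X_b * euler f.
Proof.
rewrite /euler; under eq_bigr do rewrite mderiv_mulX mulrDr -scalerAr mulrCA.
by rewrite big_split /= pick5 mulr_sumr.
Qed.

Lemma lap_mulX b f : lap ('X_b * f) = 'X_b * lap f + 2 *: f^`M(opp5 b).
Proof.
have E c : (('X_b * f)^`M(c))^`M(opp5 c) = 'X_b * (f^`M(c))^`M(opp5 c)
    + ((c == b)%:R *: f^`M(opp5 c) + (c == opp5 b)%:R *: f^`M(c)).
  have e : (opp5 c == b) = (c == opp5 b).
    by rewrite -[RHS](inj_eq (can_inj opp5K)) opp5K.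
  by rewrite mderiv_mulX mderivD mderivZ mderiv_mulX e addrA addrC.
rewrite /lap (eq_bigr _ (fun c _ => E c)) !big_split /= mulr_sumr; congr (_ + _).
rewrite (pick5 (fun c => f^`M(opp5 c))) (pick5 (fun c => f^`M(c))).
by rewrite -mul_mpolyC mpolyC_nat; ring.
Qed.

(** The correction terms are the action of the bracket with [lower b], which lies in the Levi
    factor: a multiple of h_{eps_1}, acting by lambda - E, and the so(5) vector field x_{-a} d_{-b}
    - x_b d_a. *)
Lemma raise_mulX a b f : raise a ('X_b * f) = 'X_b * raise a f
  + (a == b)%:R *: (lam *: f - euler f) - 'X_b * f^`M(a)
  + 'X_(opp5 a) * f^`M(opp5 b).
Proof.
rewrite /raise lap_mulX mderiv_mulX euler_linear euler_mulX.
have -> : 'X_(opp5 a) * ('X_b * lap f + 2 *: f^`M(opp5 b)) =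
   'X_b * ('X_(opp5 a) * lap f) + 2 *: ('X_(opp5 a) * f^`M(opp5 b)).
  by rewrite -!mul_mpolyC; ring.
rewrite [2^-1 *: (_ + _)]scalerDr scalerA mulVf ?scale1r ?pnatr_eq0 //.
by rewrite -!mul_mpolyC; ring.
Qed.

(** As 'X_b is the action of [lower b], this is the representation property for the pair (x,
    [lower b]). The general case is deduced from it. *)
Lemma rho_mulX x b f :
  rho x ('X_b * f) = 'X_b * rho x f + rho (lie x (lower b)) f.
Proof.
have e1 : \sum_a x (mid a) 0 *: ('X_a * ('X_b * f))
    = 'X_b * \sum_a x (mid a) 0 *: ('X_a * f).
  by rewrite mulr_sumr; apply: eq_bigr => a _; rewrite mulrCA scalerAr.
have e3 : \sum_a \sum_c x (mid a) (mid c) *: ('X_a * ('X_b * f)^`M(c))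
    = 'X_b * (\sum_a \sum_c x (mid a) (mid c) *: ('X_a * f^`M(c)))
      + \sum_a x (mid a) (mid b) *: ('X_a * f).
  rewrite mulr_sumr -big_split; apply: eq_bigr => a _ /=.
  rewrite -[X in _ + X](pick5 (fun c => x (mid a) (mid c) *: ('X_a * f))) mulr_sumr -big_split.
  by apply: eq_bigr => c _ /=; rewrite mderiv_mulX -!mul_mpolyC; ring.
have e4 : \sum_a x 0 (mid a) *: raise a ('X_b * f)
    = 'X_b * (\sum_a x 0 (mid a) *: raise a f)
      + x 0 (mid b) *: (lam *: f - euler f)
      - \sum_a x 0 (mid a) *: ('X_b * f^`M(a))
      + \sum_a x 0 (mid a) *: ('X_(opp5 a) * f^`M(opp5 b)).
  rewrite -[X in _ + X - _](pick5 (fun c => x 0 (mid c) *: (lam *: f - euler f))).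
  rewrite mulr_sumr -big_split /= -sumrB -big_split /=; apply: eq_bigr => a _ /=.
  by rewrite raise_mulX -!mul_mpolyC; ring.
have l1 : \sum_a lie x (lower b) (mid a) 0 *: ('X_a * f)
    = \sum_a x (mid a) (mid b) *: ('X_a * f) - x 0 0 *: ('X_b * f).
  rewrite -[X in _ - X](pick5 (fun a => x 0 0 *: ('X_a * f))) -sumrB.
  by apply: eq_bigr => a _; rewrite lie_lower_mid0 -!mul_mpolyC mpolyCB mpolyCM; ring.
have l3 : \sum_a \sum_c lie x (lower b) (mid a) (mid c) *: ('X_a * f^`M(c))
    = \sum_a x 0 (mid a) *: ('X_(opp5 a) * f^`M(opp5 b))
      - \sum_a x 0 (mid a) *: ('X_b * f^`M(a)).
  rewrite [X in _ = X - _](reindex_inj (can_inj opp5K)) /=.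
  rewrite -[X in _ - X](pick5 (fun b => \sum_a x 0 (mid a) *: ('X_b * f^`M(a)))) -sumrB.
  apply: eq_bigr => a _; rewrite opp5K scaler_sumr.
  rewrite -[X in _ = X - _](pick5 (fun c => x 0 (mid (opp5 a)) *: ('X_a * f^`M(c)))) -sumrB.
  apply: eq_bigr => c _; rewrite lie_lower_mid -!mul_mpolyC mpolyCB !mpolyCM; ring.
rewrite rhoE /rho_def e1 e3 e4 l1 l3 lie_lower00 euler_mulX.
rewrite [X in _ = _ + (_ + X)]big1 ?addr0; last first.
  by move=> a _; rewrite lie_lower0_mid scale0r.
by rewrite -!mul_mpolyC; ring.
Qed.

Lemma mpoly_mulX_ind n (W : {mpoly K[n]} -> Prop) :
  W 1 -> (forall (a : K) (f g : {mpoly K[n]}), W f -> W g -> W (a *: f + g)) ->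
  (forall (b : 'I_n) (f : {mpoly K[n]}), W f -> W ('X_b * f)) -> forall f : {mpoly K[n]}, W f.
Proof.
move=> W1 WD WX.
have W0 : W 0 by have := WD (-1) 1 1 W1 W1; rewrite scaleN1r addNr.
elim/mpolyind => // c m f _ _ Wf; apply: WD => //.
rewrite mpolyXE_id; elim/big_rec: _ => // i g _ Wg.
elim: (m i) => [|k IH]; first by rewrite expr0 mul1r.
by rewrite exprS -mulrA; apply: WX.
Qed.

Lemma rho1 x :
  rho x 1 = \sum_(a < 5) x (mid a) 0 *: 'X_a + (lam * x 0 0) *: 1.
Proof.
have d1 c : (1 : P)^`M(c) = 0 by rewrite -mpolyC1 mderivC.
have e1 : euler 1 = 0 by rewrite /euler big1 // => c _; rewrite d1 mulr0.
rewrite rhoE /rho_def e1 subr0 scalerA [x 0 0 * _]mulrC.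
rewrite [X in _ + X + _]big1 ?addr0 => [|a _]; last first.
  by rewrite big1 // => b _; rewrite d1 mulr0 scaler0.
rewrite [X in _ + X]big1 ?addr0 => [|a _].
  by congr (_ + _); apply: eq_bigr => a _; rewrite mulr1.
rewrite /raise d1 (lin0 euler_linear) /lap big1 => [|c _]; last by rewrite d1 linear0.
by rewrite mulr0 !scaler0 subr0 addr0 scaler0.
Qed.

(* Both sides satisfy the same recursion under multiplication by a variable, so it
   suffices to compare them on 1. *)
Lemma rho_lie x y f : rho (lie x y) f = rho x (rho y f) - rho y (rho x f).
Proof.
elim/mpoly_mulX_ind: f x y => [x y|a f g IHf IHg x y|b f]; last 2 first.
- rewrite (rho_linear (lie x y)) !(rho_linear y, rho_linear x) IHf IHg.
  by rewrite scalerBr opprD addrACA.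
- move=> IH x y; rewrite !(rho_mulX, linD (rho_linear _)) IH.
  have -> : lie (lie x y) (lower b) = lie x (lie y (lower b)) - lie y (lie x (lower b)).
    have := lie_jacobi x y (lower b) => /eqP.
    have anti u v : lie u v = - lie v u :> so7 K.
      by apply/val_inj => /=; rewrite opprB.
    rewrite (anti (lower b) x) (anti (lower b) (lie x y)).
    by rewrite (linN (lie_linearr y)) subr_eq0 => /eqP ->.
  by rewrite (linB (rho_linearl f)) !IH; ring.
(* The product [rho u 1 * rho v 1] is symmetric in u and v, so it drops out of the commutator and
   only the bracket corrections are left to compare. *)
have step u v : rho u (rho v 1) = rho u 1 * rho v 1
    + \sum_b v (mid b) 0 *: rho (lie u (lower b)) 1.
  rewrite [rho v 1 in LHS]rho1 (linD (rho_linear u)) (lin_sum (rho_linear u)).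
  rewrite (linZ (rho_linear u)) [rho v 1]rho1 mulrDr mulr_sumr [RHS]addrAC -big_split /=.
  congr (_ + _); last by rewrite -scalerAr mulr1.
  apply: eq_bigr => b _; rewrite (linZ (rho_linear u)) -[X in rho u X]mulr1 rho_mulX.
  by rewrite -!mul_mpolyC; ring.
have sumE u v : \sum_b v (mid b) 0 *: rho (lie u (lower b)) 1 =
    \sum_a (\sum_b u (mid a) (mid b) * v (mid b) 0 - v (mid a) 0 * u 0 0) *: 'X_a
    + (lam * \sum_b u 0 (mid b) * v (mid b) 0) *: 1.
  rewrite mulr_sumr scaler_suml.
  under eq_bigr do rewrite rho1 scalerDr lie_lower00 scaler_sumr.
  rewrite big_split exchange_big /=; congr (_ + _); last first.
    by apply: eq_bigr => b _; rewrite scalerA [v _ _ * _]mulrC mulrA.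
  apply: eq_bigr => a _.
  have -> : v (mid a) 0 * u 0 0 = \sum_b (b == a)%:R * (v (mid b) 0 * u 0 0).
    by rewrite (bigD1 a) //= eqxx mul1r big1 ?addr0 // => b /negPf ->; rewrite mul0r.
  rewrite -sumrB scaler_suml; apply: eq_bigr => b _.
  by rewrite scalerA lie_lower_mid0 [a == b]eq_sym; congr (_ *: _); ring.
rewrite !step [rho y 1 * _]mulrC opprD addrACA subrr add0r !sumE rho1.
rewrite opprD addrACA -sumrB -scalerBl; congr (_ + _ *: _).
  apply: eq_bigr => a _; rewrite -scalerBl; congr (_ *: _).
  by rewrite so7_lieE !sum_mid !so7_entry40; ring.
by rewrite so7_lieE !sum_mid !so7_entry40; ring.
Qed.
End Model.

(** Needed for evaluation in the noncommutative ring U(so(7)). The induction also carries that the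
    partial product commutes with each [h j], so that the next power can be moved past it. *)
Lemma mmap1_comm (n : nat) (S : nzRingType) (h : 'I_n -> S) m1 m2 :
  (forall i j, GRing.comm (h i) (h j)) ->
  mmap1 h (m1 + m2) = mmap1 h m1 * mmap1 h m2.
Proof.
move=> hC; rewrite /mmap1.
suff [] : \prod_(i < n) h i ^+ (m1 + m2)%MM i =
    \prod_(i < n) h i ^+ m1 i * \prod_(i < n) h i ^+ m2 i /\
    forall j, GRing.comm (\prod_(i < n) h i ^+ m1 i) (h j) by [].
elim/big_rec3: _ => [|i y1 y2 y3 _ [-> y2C]].
  by rewrite mulr1; split => // j; apply/commr_sym/commr1.
split=> [|j].
  rewrite mnmDE exprD -!mulrA; congr (_ * _); rewrite !mulrA; congr (_ * _).
  by apply/commr_sym/commrX/y2C.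
apply/commr_sym/commrM; last exact/commr_sym/y2C.
exact/commrX/hC.
Qed.

(** * Elementary skew matrices and the action of p on the constant polynomial *)

Section Verma.
Context (K : numClosedFieldType) (lam : K).
Implicit Types x y : so7 K.
Local Notation P := {mpoly K[5]}.

Definition sk i j : so7 K := So7 (@skew_unit_skewB K i j).

Lemma skE i j k l : sk i j k l =
  ((k == i) && (l == j))%:R - ((k == negp j) && (l == negp i))%:R.
Proof. by rewrite /= !mxE. Qed.

Lemma sk_anti i j : sk i j = - sk (negp j) (negp i).
Proof. by apply/val_inj; rewrite /= /skew_unit_mx !negpK opprB. Qed.

Lemma sk0 i : sk i (negp i) = 0.
Proof. by apply/val_inj; rewrite /= /skew_unit_mx !negpK subrr. Qed.

Lemma so7_sumE (I : Type) (r : seq I) (F : I -> so7 K) k l :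
  (\sum_(i <- r) F i) k l = \sum_(i <- r) F i k l.
Proof. by elim/big_rec2: _ => [|i _ y _ <-]; rewrite ?mxE // so7_DE. Qed.

Lemma so7_span (W : set (so7 K)) :
  subspace W -> (forall i j, W (sk i j)) -> forall x, W x.
Proof.
move=> sW Wsk x.
(* The factor 1/2 compensates for [sk i j] and [sk (negp j) (negp i)] being opposite: each matrix
   entry is met twice. *)
have -> : x = \sum_i \sum_j (2^-1 * x i j) *: sk i j; last first.
  by do 2!apply: subspace_sum => // ?; apply: subspaceZ.
apply/val_inj/matrixP => k l /=; rewrite so7_sumE.
under eq_bigr do rewrite so7_sumE.
under eq_bigr do under eq_bigr do rewrite so7_ZE skE mulrBr.
under eq_bigr do rewrite sumrB; rewrite sumrB /=.
rewrite (bigD1 k) //= (bigD1 l) //= !eqxx mulr1 big1 ?addr0; last first.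
  by move=> j; rewrite eq_sym => /negPf ->; rewrite mulr0.
rewrite big1 ?addr0; last first.
  by move=> i; rewrite eq_sym => /negPf ik; rewrite big1 // => j _; rewrite ik mulr0.
rewrite (bigD1 (negp l)) //= (bigD1 (negp k)) //= !negpK !eqxx mulr1 big1 ?addr0; last first.
  move=> j /negPf jk; rewrite [k == _]eq_sym -(inj_eq (can_inj negpK)) negpK.
  by rewrite jk mulr0.
rewrite big1 ?addr0; last first.
  move=> i /negPf il; rewrite big1 // => j _.
  by rewrite [l == _]eq_sym -[negp i == l](inj_eq (can_inj negpK)) negpK il andbF mulr0.
rewrite -[so7_mx x (negp l) (negp k)]opprK -so7_entry mulrN opprK -mulrDr.
by field.
Qed.

(** This is [l, l] + n: by [rho1], the elements that annihilate the constant 1 whatever lambda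
    is. *)
Definition kills1 : set (so7 K) := [set x | x 0 0 = 0 /\ forall a, x (mid a) 0 = 0]%classic.
(** The Levi factor l described by its block shape; the blocks involving e_{-1} are taken care of by
    skewness. *)
Definition block : set (so7 K) :=
  [set x | forall a, x (mid a) 0 = 0 /\ x 0 (mid a) = 0]%classic.

Lemma kills1_subspace : subspace kills1.
Proof.
split=> [|k x y [x0 xa] [y0 ya]]; first by split=> [|a]; rewrite /= mxE.
by split=> [|a]; rewrite so7_DE so7_ZE ?x0 ?y0 ?xa ?ya mulr0 addr0.
Qed.

Lemma block_subspace : subspace block.
Proof.
split=> [a|k x y xb yb a]; first by split; rewrite /= mxE.
have [x1 x2] := xb a; have [y1 y2] := yb a.
by split; rewrite so7_DE so7_ZE ?x1 ?y1 ?x2 ?y2 mulr0 addr0.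
Qed.

Ltac entries := rewrite /= !mxE -?val_eqE /= ?subrr ?subr0 ?mulr0 ?addr0 ?oppr0 //.
Ltac case5 a := case: a => [[|[|[|[|[|//]]]]] ?].

Lemma cartan_block x : cartan x -> block x.
Proof.
apply: lspan_min; first exact: block_subspace.
move=> {}x /=; rewrite !inE => /orP[/eqP->|/orP[/eqP->|/eqP->]] a;
  by case5 a; split; entries.
Qed.

Lemma levi_block x : levi x -> block x.
Proof.
apply: lspan_min; first exact: block_subspace.
move=> {}x [/cartan_block //|] /=; rewrite !inE.
by do ![case/orP]; move/eqP-> => a; case5 a; split; entries.
Qed.

Lemma nilrad_kills1 x : nilrad x -> kills1 x.
Proof.
apply: lspan_min; first exact: kills1_subspace.
move=> {}x /=; rewrite !inE.
by do ![case/orP]; move/eqP->; (split=> [|a]; [|case5 a]); entries.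
Qed.

(** For block diagonal matrices the entry at e_1 is a block of size 1, hence commutative, so it
    vanishes on brackets. *)
Lemma derived_levi_block x : derived (@levi K) x -> block x /\ x 0 0 = 0.
Proof.
move: x; apply: (@lspan_min _ _ _ [set x | block x /\ x 0 0 = 0]%classic).
  split=> [|k x y [bx x0] [by_ y0]]; first by split; [exact: block_subspace.1|rewrite mxE].
  split; first exact: block_subspace.2.
  by rewrite so7_DE so7_ZE x0 y0 mulr0 addr0.
move=> _ [x [y [/levi_block bx /levi_block by_ ->]]].
split=> [a|].
  have [x1 x2] := bx a; have [y1 y2] := by_ a.
  split; rewrite so7_lieE !sum_mid ?so7_entry40 ?so7_entry04 ?x1 ?x2 ?y1 ?y2;
    rewrite !mulr0 !mul0r !add0r.
    rewrite big1 => [|b _]; last by have [-> _] := by_ b; rewrite mulr0.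
    rewrite big1 => [|b _]; last by have [-> _] := bx b; rewrite mulr0.
    by rewrite subrr.
  rewrite big1 => [|b _]; last by have [_ ->] := bx b; rewrite mul0r.
  rewrite big1 => [|b _]; last by have [_ ->] := by_ b; rewrite mul0r.
  by rewrite subrr.
rewrite so7_lieE !sum_mid ?so7_entry40 ?so7_entry04 !mulr0.
rewrite big1 => [|b _]; last by have [_ ->] := bx b; rewrite mul0r.
rewrite big1 => [|b _]; last by have [_ ->] := by_ b; rewrite mul0r.
by rewrite !addr0 mulrC subrr.
Qed.

Lemma derived_levi_kills1 x : derived (@levi K) x -> kills1 x.
Proof. by move=> /derived_levi_block [bx x0]; split=> // a; have [] := bx a. Qed.

Lemma rho_kills1 x : kills1 x -> rho lam x 1 = 0.
Proof.
move=> [x0 xa]; rewrite rho1 x0 mulr0 scale0r addr0 big1 // => a _.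
by rewrite xa scale0r.
Qed.

Lemma Clambda_rho x a : Clambda lam x a -> rho lam x 1 = a *: 1.
Proof.
case=> h y n hc yd nn; rewrite !(linD (rho_linearl lam 1)).
rewrite (rho_kills1 (derived_levi_kills1 yd)) (rho_kills1 (nilrad_kills1 nn)) !addr0.
rewrite rho1 big1 ?add0r //; last by move=> b _; rewrite (cartan_block hc b).1 scale0r.
by rewrite /eps; congr (lam * so7_mx h _ _ *: _); apply/val_inj.
Qed.
End Verma.

(** * The isomorphism between the polynomial model and M_lambda *)

Section Iso.
Context (K : numClosedFieldType) (lam : K).
Implicit Types x y : so7 K.
Local Notation P := {mpoly K[5]}.
Local Notation sk := (@sk K).

Lemma sqrt2_neq0 : sqrtC 2 != 0 :> K.
Proof. by rewrite sqrtC_eq0 pnatr_eq0. Qed.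

(** Up to the antisymmetry [sk_anti] and the vanishing of [sk i (negp i)], the 25 pairs reduce to
    root vectors of l and to h_{eps_2}, h_{eps_3}; [E] compares positions as numbers, so the cases
    are settled by search. *)
Lemma levi_mid a b : levi (sk (mid a) (mid b)).
Proof.
have sW := lspan_subspace [set x : so7 K | cartan x \/
    x \in [:: gadd K 2 3; gaddN K 2 3; gsub K 2 3; gsub K 3 2;
              gshort K 2; gshortN K 2; gshort K 3; gshortN K 3]]%classic.
have gen x : x \in [:: gadd K 2 3; gaddN K 2 3; gsub K 2 3; gsub K 3 2;
              gshort K 2; gshortN K 2; gshort K 3; gshortN K 3] -> levi x.
  by move=> xin; apply: sub_lspan; right.
have hgen x : x \in [:: hcart K 1; hcart K 2; hcart K 3] -> levi x.
  by move=> xin; apply: sub_lspan; left; apply: sub_lspan.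
have anti i j : levi (sk (negp j) (negp i)) -> levi (sk i j).
  by move=> L; rewrite sk_anti; exact: (subspaceN sW L).
have zero i : levi (sk i (negp i)) by rewrite sk0; exact: sW.1.
have short i j : levi (sqrtC 2 *: sk i j) -> levi (sk i j).
  move=> L; rewrite -[sk i j]scale1r -(mulVf sqrt2_neq0) -scalerA.
  exact: (subspaceZ _ sW L).
have E (i j k l : 'I_7) : val i = val k -> val j = val l -> levi (sk k l) -> levi (sk i j).
  by move=> /val_inj -> /val_inj ->.
have g23 : levi (sk (pos 2) (pos 3)).
  by rewrite -[sk _ _]/(gsub K 2 3); apply: gen; rewrite !inE eqxx ?orbT.
have g32 : levi (sk (pos 3) (pos 2)).
  by rewrite -[sk _ _]/(gsub K 3 2); apply: gen; rewrite !inE eqxx ?orbT.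
have a23 : levi (sk (pos 2) (pos (-3))).
  by rewrite -[sk _ _]/(gadd K 2 3); apply: gen; rewrite !inE eqxx ?orbT.
have a32 : levi (sk (pos (-3)) (pos 2)).
  by rewrite -[sk _ _]/(gaddN K 2 3); apply: gen; rewrite !inE eqxx ?orbT.
have s2 : levi (sk (pos 2) (pos 0)).
  by apply: short; rewrite -[_ *: _]/(gshort K 2); apply: gen; rewrite !inE eqxx ?orbT.
have s3 : levi (sk (pos 3) (pos 0)).
  by apply: short; rewrite -[_ *: _]/(gshort K 3); apply: gen; rewrite !inE eqxx ?orbT.
have t2 : levi (sk (pos 0) (pos 2)).
  by apply: short; rewrite -[_ *: _]/(gshortN K 2); apply: gen; rewrite !inE eqxx ?orbT.
have t3 : levi (sk (pos 0) (pos 3)).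
  by apply: short; rewrite -[_ *: _]/(gshortN K 3); apply: gen; rewrite !inE eqxx ?orbT.
have h2 : levi (sk (pos 2) (pos 2)).
  by rewrite -[sk _ _]/(hcart K 2); apply: hgen; rewrite !inE eqxx ?orbT.
have h3 : levi (sk (pos 3) (pos 3)).
  by rewrite -[sk _ _]/(hcart K 3); apply: hgen; rewrite !inE eqxx ?orbT.
case: a b => [[|[|[|[|[|//]]]]] ?] [[|[|[|[|[|//]]]]] ?];
  by [ apply: E h2 | apply: E h3 | apply: E g23 | apply: E g32 | apply: E a23
     | apply: E a32 | apply: E s2 | apply: E s3 | apply: E t2 | apply: E t3
     | apply: E (zero (pos 2)) | apply: E (zero (pos 3)) | apply: E (zero (pos 0))
     | apply: E (zero (pos (-2))) | apply: E (zero (pos (-3)))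
     | apply: anti; apply: E h2 | apply: anti; apply: E h3 | apply: anti; apply: E g23
     | apply: anti; apply: E g32 | apply: anti; apply: E a23 | apply: anti; apply: E a32
     | apply: anti; apply: E s2 | apply: anti; apply: E s3 | apply: anti; apply: E t2
     | apply: anti; apply: E t3 ].
Qed.

Lemma nilrad_mid a : nilrad (sk 0 (mid a)).
Proof.
have gen x : x \in [:: gshort K 1; gadd K 1 2; gsub K 1 2; gadd K 1 3; gsub K 1 3] -> nilrad x.
  by move=> xin; apply: sub_lspan.
have E (i j k l : 'I_7) : val i = val k -> val j = val l -> nilrad (sk k l) -> nilrad (sk i j).
  by move=> /val_inj -> /val_inj ->.
case: a => [[|[|[|[|[|//]]]]] ?].
- by apply: E (gen (gsub K 1 2) _); rewrite // !inE eqxx ?orbT.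
- by apply: E (gen (gsub K 1 3) _); rewrite // !inE eqxx ?orbT.
- apply: (E _ _ (pos 1) (pos 0)) => //.
  rewrite -[sk _ _]scale1r -(mulVf sqrt2_neq0) -scalerA.
  apply: (subspaceZ _ (lspan_subspace _)).
  by rewrite -[_ *: _]/(gshort K 1); apply: gen; rewrite !inE eqxx ?orbT.
- by apply: E (gen (gadd K 1 2) _); rewrite // !inE eqxx ?orbT.
- by apply: E (gen (gadd K 1 3) _); rewrite // !inE eqxx ?orbT.
Qed.

Definition so7_diag x := forall i j, i != j -> x i j = 0.

Lemma lie_diagE x y i j : so7_diag x -> lie x y i j = (x i i - x j j) * y i j.
Proof.
move=> dx; rewrite so7_lieE (bigD1 i) //= big1 ?addr0 => [|k ki]; last first.
  by rewrite dx 1?eq_sym // mul0r.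
rewrite (bigD1 j) //= big1 ?addr0 => [|k kj]; last by rewrite dx // mulr0.
by rewrite mulrBl [y i j * _]mulrC.
Qed.

Lemma sk_diag i : so7_diag (sk i i).
Proof.
move=> k l kl; rewrite skE.
have E (c : 'I_7) : (k == c) && (l == c) = false.
  by apply/negP => /andP[/eqP kc /eqP lc]; rewrite kc lc eqxx in kl.
by rewrite !E subrr.
Qed.

Lemma cartan_diag x : cartan x -> so7_diag x.
Proof.
apply: (@lspan_min _ _ _ [set x | so7_diag x]%classic).
  split=> [i j _|k {}x y dx dy i j ij]; first by rewrite /= mxE.
  by rewrite so7_DE so7_ZE dx // dy // mulr0 addr0.
move=> {}x /=; rewrite !inE.
by do ![case/orP]; move/eqP->; exact: sk_diag.
Qed.

Lemma lie_diag_sk (h : so7 K) i j :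
  so7_diag h -> lie h (sk i j) = (h i i - h j j) *: sk i j.
Proof.
move=> dh; apply/val_inj/matrixP => a b; rewrite (lie_diagE _ _ _ dh).
rewrite so7_ZE [sk i j a b]skE !mulrBr; congr (_ - _).
  by case: (a =P i) => [->|_]; case: (b =P j) => [->|_]; rewrite /= ?mulr0.
case: (a =P _) => [->|_]; case: (b =P _) => [->|_]; rewrite /= ?mulr0 //.
by rewrite !mulr1 [in RHS](so7_entry _ i) [in RHS](so7_entry _ j) opprK addrC.
Qed.

(* The weights of the middle basis vectors under h_{eps_2}, h_{eps_3} are pairwise
   distinct, which makes every off-diagonal root vector a bracket. *)
Lemma derived_levi_mid a b : a != b -> derived (@levi K) (sk (mid a) (mid b)).
Proof.
move=> ab; pose w k : K :=
  sk (mid k) (mid k) (mid a) (mid a) - sk (mid k) (mid k) (mid b) (mid b).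
suff [k wk] : exists k, w k != 0.
  rewrite -[sk _ _]scale1r -(mulVf wk) -scalerA -(lie_diag_sk _ _ (@sk_diag _)).
  apply: (subspaceZ _ (lspan_subspace _)); apply: sub_lspan.
  by do 2!eexists; split; last reflexivity; exact: levi_mid.
have wE k : w k = ((a == k)%:R - (a == opp5 k)%:R) - ((b == k)%:R - (b == opp5 k)%:R).
  by rewrite /w !skE !negp_mid !mid_eq !andbb.
have two : 2 != 0 :> K by rewrite pnatr_eq0.
have one : 1 != 0 :> K by rewrite oner_eq0.
move: (wE 0) (wE 1); move: ab; rewrite -!val_eqE.
case: a b w wE => [[|[|[|[|[|//]]]]] ?] [[|[|[|[|[|//]]]]] ?] w _ //= _ w0 w1;
by [exists 0; rewrite w0 ?subr0 ?sub0r ?opprK ?oppr_eq0 -?opprD ?oppr_eq0 // ?two ?one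
   |exists 1; rewrite w1 ?subr0 ?sub0r ?opprK ?oppr_eq0 -?opprD ?oppr_eq0 // ?two ?one].
Qed.

Lemma lowerE b i j : lower K b i j = (i == mid b)%:R * (j == 0)%:R
  - (i == negp 0)%:R * (j == mid (opp5 b))%:R.
Proof. by rewrite [lower _ _ _ _]skE negp_mid -!natrM !mulnb. Qed.

Lemma rho_lower b f : rho lam (lower K b) f = 'X_b * f.
Proof.
rewrite rhoE /rho_def lowerE ![0 == _]eq_sym !mid_eq0 !mul0r subr0.
rewrite [X in _ + X + _]big1 ?addr0 => [|a _]; last first.
  rewrite big1 // => c _.
  by rewrite lowerE !mid_eq0 mid_eq4 mulr0 mul0r subr0 scale0r.
rewrite [X in _ + X]big1 ?addr0 => [|a _]; last first.
  by rewrite lowerE ![0 == _]eq_sym !mid_eq0 !mul0r subr0 scale0r.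
rewrite scale0r addr0 -[RHS](pick5 (fun a => 'X_a * f)).
by apply: eq_bigr => a _; rewrite lowerE mid_eq mid_eq4 eqxx mulr1 mul0r subr0.
Qed.

Section Psi.
(** The map S(n_-) -> M_lambda applying a polynomial in the commuting elements [lower b] to the
    highest weight vector. *)
Definition Psi (f : P) : verma lam :=
  verma_act lam (mmap (in_alg (envel (so7 K))) (fun b => env_in (lower K b)) f)
    (verma_hw lam).

Lemma lie_lower a b : lie (lower K a) (lower K b) = 0.
Proof.
apply/val_inj/matrixP => i j; rewrite lie_lowerE !lowerE !mid_eq0 !mid_eq4 !mid_eq.
rewrite ![0 == _]eq_sym !mid_eq0 [so7_mx 0 i j]mxE.
have -> : (opp5 b == a) = (b == opp5 a) by rewrite -(inj_eq (can_inj opp5K)) opp5K.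
have -> : (negp 0 == 0 :> 'I_7) = false by [].
by rewrite [negp 0 == mid _]eq_sym mid_eq4 (_ : false%:R = 0 :> K) //; ring.
Qed.

Lemma env_lower_comm a b :
  GRing.comm (env_in (lower K a)) (env_in (lower K b)).
Proof.
apply/eqP; rewrite -subr_eq0 -env_in_lie lie_lower.
by rewrite (lin0 (@env_in_linear _ _)).
Qed.

Lemma Psi_linear : linear Psi.
Proof.
move=> a f g; rewrite /Psi mmapD mmapZ /= mulr_algl.
exact: (ind_act_linearl (verma_hw lam)).
Qed.

Lemma Psi1 : Psi 1 = verma_hw lam.
Proof. by rewrite /Psi -mpolyC1 mmapC /= scale1r; exact: ind_act1. Qed.

Lemma Psi_mulX b f : Psi ('X_b * f) = verma_act lam (env_in (lower K b)) (Psi f).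
Proof.
rewrite /Psi /verma_act -ind_actM; congr (ind_act _ _).
elim/mpolyind: f => [|c m f _ _ IH]; first by rewrite mulr0 mmap0 mulr0.
rewrite mulrDr !mmapD mulrDr IH; congr (_ + _).
rewrite -scalerAr !mmapZ /= !mulr_algl -scalerAr; congr (_ *: _).
rewrite -mpolyXD !mmapX mmap1_comm; last exact: env_lower_comm.
by rewrite mmap1U.
Qed.

(** Both sides are linear in x, so elementary skew matrices suffice. Those in p act on both sides
    through the inducing character, and those in n_- act by a variable. Middle diagonal elements are
    treated as Cartan elements, the off-diagonal ones as elements of [l, l]. *)
Lemma hw_act x : verma_act lam (env_in x) (verma_hw lam) = Psi (rho lam x 1).
Proof.
pose W :=
  [set x : so7 K | verma_act lam (env_in x) (verma_hw lam) = Psi (rho lam x 1)]%classic.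
have sW : subspace W.
  have L : linear (fun x => verma_act lam (env_in x) (verma_hw lam)).
    by move=> a u v; rewrite env_in_linear; exact: ind_act_linearl.
  have L' : linear (fun x => Psi (rho lam x 1)).
    by move=> a u v; rewrite rho_linearl Psi_linear.
  split=> [|a u v /= Wu Wv]; first by rewrite /W /= (lin0 L) (lin0 L').
  by rewrite /W /= L L' Wu Wv.
have WC y a : Clambda lam y a -> W y.
  by move=> ya; rewrite /W /= (Clambda_rho ya) (linZ Psi_linear) Psi1; exact: ind_gen_act.
have C0 : cartan (0 : so7 K) by exact: (lspan_subspace _).1.
have D0 : derived (@levi K) 0 by exact: (lspan_subspace _).1.
have N0 : nilrad (0 : so7 K) by exact: (lspan_subspace _).1.
have Wc y : cartan y -> W y.
  by move=> cy; have := @ClambdaAct K lam _ _ _ cy D0 N0; rewrite !addr0; exact: WC.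
have Wd y : derived (@levi K) y -> W y.
  by move=> dy; have := @ClambdaAct K lam _ _ _ C0 dy N0; rewrite addr0 add0r; exact: WC.
have Wn y : nilrad y -> W y.
  by move=> ny; have := @ClambdaAct K lam _ _ _ C0 D0 ny; rewrite !add0r; exact: WC.
have Wanti i j : W (sk (negp j) (negp i)) -> W (sk i j).
  by rewrite (sk_anti K i); exact: subspaceN.
have Wzero i : W (sk i (negp i)) by rewrite sk0; exact: sW.1.
have Wlow b : W (sk (mid b) 0).
  rewrite -[sk _ _]/(lower K b) /W /= -Psi1 -Psi_mulX; congr Psi.
  by rewrite rho_lower.
have Wmid a b : W (sk (mid a) (mid b)).
  have [<-|ab] := eqVneq a b; last by apply: Wd; exact: derived_levi_mid.
  have E i (j : 'I_7) : val i = val j -> W (sk j j) -> W (sk i i) by move/val_inj->.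
  have W2 : W (sk (pos 2) (pos 2)).
    by rewrite -[sk _ _]/(hcart K 2); apply: Wc; apply: sub_lspan; rewrite /= !inE eqxx ?orbT.
  have W3 : W (sk (pos 3) (pos 3)).
    by rewrite -[sk _ _]/(hcart K 3); apply: Wc; apply: sub_lspan; rewrite /= !inE eqxx ?orbT.
  case: a => [[|[|[|[|[|//]]]]] ?].
  - by apply: E W2.
  - by apply: E W3.
  - by apply: E (Wzero (pos 0)).
  - by apply: Wanti; apply: E W2.
  - by apply: Wanti; apply: E W3.
have W00 : W (sk 0 0).
  have -> : sk 0 0 = hcart K 1 by congr (sk _ _); exact/val_inj.
  by apply: Wc; apply: sub_lspan; rewrite /= !inE eqxx.
have idx (i : 'I_7) : [\/ i = 0, i = negp 0 | exists a, i = mid a].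
  case: i => [[|[|[|[|[|[|[|//]]]]]]] ?].
  - by constructor 1; exact/val_inj.
  - by constructor 3; exists 0; exact/val_inj.
  - by constructor 3; exists 1; exact/val_inj.
  - by constructor 3; exists (inZp 2); exact/val_inj.
  - by constructor 2; exact/val_inj.
  - by constructor 3; exists (inZp 3); exact/val_inj.
  - by constructor 3; exists (inZp 4); exact/val_inj.
rewrite -/(W x); apply: (so7_span sW) => i j.
case: (idx i) (idx j) => [->|->|[a ->]] [->|->|[b ->]].
- exact: W00.
- exact: Wzero.
- by apply: Wn; exact: nilrad_mid.
- by have := Wzero (negp 0); rewrite negpK.
- by apply: Wanti; rewrite !negpK.
- by apply: Wanti; rewrite negpK negp_mid.
- exact: Wlow.
- by apply: Wanti; rewrite negpK negp_mid; apply: Wn; exact: nilrad_mid.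
- exact: Wmid.
Qed.

(** Moving x past [lower b] in U(so(7)) creates the same bracket term as [rho_mulX], so the
    intertwining property spreads from 1 to all polynomials. *)
Lemma Psi_rho x f : verma_act lam (env_in x) (Psi f) = Psi (rho lam x f).
Proof.
elim/mpoly_mulX_ind: f x => [x|a f g IHf IHg x|b f IH x].
- by rewrite Psi1 hw_act.
- rewrite Psi_linear rho_linear Psi_linear -IHf -IHg.
  exact: ind_act_linearr.
have -> : verma_act lam (env_in x) (Psi ('X_b * f)) =
    verma_act lam (env_in (lower K b)) (verma_act lam (env_in x) (Psi f))
    + verma_act lam (env_in (lie x (lower K b))) (Psi f).
  have E : env_in x * env_in (lower K b) =
      env_in (lower K b) * env_in x + env_in (lie x (lower K b)).
    by rewrite env_in_lie addrC subrK.
  rewrite Psi_mulX /verma_act -[LHS]ind_actM E -[ind_act (env_in (lower K b)) _]ind_actM.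
  exact: (linD (ind_act_linearl (Psi f))).
by rewrite !IH rho_mulX (linD Psi_linear) Psi_mulX.
Qed.

(** [Phi] comes from [induced_universal] and [Psi] from evaluation. Both commute with the action and
    match v_lambda with 1, so each composition fixes a cyclic vector and is the identity. *)
Lemma verma_iso : exists Phi : verma lam -> P,
  [/\ linear Phi, cancel Phi Psi & cancel Psi Phi] /\
  forall x v, Phi (verma_act lam (env_in x) v) = rho lam x (Phi v).
Proof.
have [Phi [Phi_lin Phi_hw Phi_act]] := @induced_universal K _ P (rho lam)
  (rho_linear lam) (rho_linearl lam) (rho_lie lam) (Clambda lam) 1 (@Clambda_rho K lam).
exists Phi; split=> //; split=> // [v|f].
  suff : forall v : induced (Clambda lam), [set v | Psi (Phi v) = v]%classic v by apply.
  apply: induced_ind => [||x m /= IH].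
  - split=> [|a u w /= uE wE]; first by rewrite /= (lin0 Phi_lin) (lin0 Psi_linear).
    by rewrite /= Phi_lin Psi_linear uE wE.
  - by rewrite /= Phi_hw Psi1.
  - by rewrite Phi_act -Psi_rho IH.
elim/mpoly_mulX_ind: f => [|a f g IHf IHg|b f IH].
- by rewrite Psi1.
- by rewrite Psi_linear Phi_lin IHf IHg.
by rewrite Psi_mulX Phi_act IH rho_lower.
Qed.
End Psi.
End Iso.

(** * Invariants of so(5) in S(n_-) *)

Section Coefficients.
Context (n : nat) (R : nzRingType).
Implicit Types (f g : {mpoly R[n]}) (m : 'X_{1..n}).

Lemma mcoeffXM a f m : ('X_a * f)@_(m + U_(a)) = f@_m.
Proof. by rewrite -[_ * f]commr_mpolyX addmC mcoeffMX. Qed.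

Lemma mcoeffXM0 a f m : m a = 0%N -> ('X_a * f)@_m = 0.
Proof.
move=> ma; elim/mpolyind: f => [|c m' f _ _ IH]; first by rewrite mulr0 mcoeff0.
rewrite mulrDr mcoeffD IH addr0 -[_ * (_ *: _)]commr_mpolyX -scalerAl mcoeffZ -mpolyXD mcoeffX.
case: eqP => [E|]; rewrite ?mulr0 //.
by move: ma; rewrite -E mnmDE mnm1E eqxx addn1.
Qed.

Lemma mcoeff_Xderiv a b f m :
  ('X_a * f^`M(b))@_(m + U_(a)) = f@_(m + U_(b)) *+ (m b).+1.
Proof. by rewrite mcoeffXM mcoeff_deriv. Qed.

Lemma mcoeff_Xderivv a f m : ('X_a * f^`M(a))@_m = f@_m *+ m a.
Proof.
case E: (m a) => [|k]; first by rewrite mcoeffXM0 // mulr0n.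
have -> : m = ((m - U_(a)) + U_(a))%MM.
  by rewrite submK //; apply/mnm_lepP => i; rewrite mnm1E; case: eqP => // <-; rewrite E.
by rewrite mcoeff_Xderiv mnmBE mnm1E eqxx E subn1.
Qed.
End Coefficients.

(* The exponents are listed in the order e_2, e_3, e_{-2}, e_{-3}, e_0. *)
Definition mon i j k l n : 'X_{1..5} :=
  [multinom nth 0%N [:: i; j; n; k; l] (a : 'I_5) | a < 5].

Lemma mon_eq (m : 'X_{1..5}) :
  m = mon (m (inZp 0)) (m (inZp 1)) (m (inZp 3)) (m (inZp 4)) (m (inZp 2)).
Proof.
by apply/mnmP => a; rewrite mnmE; case: a => [[|[|[|[|[|//]]]]] ?];
  congr (m _); apply/val_inj.
Qed.

Definition i0 : 'I_5 := inZp 0.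
Definition i1 : 'I_5 := inZp 1.
Definition i2 : 'I_5 := inZp 2.
Definition i3 : 'I_5 := inZp 3.
Definition i4 : 'I_5 := inZp 4.

Lemma monS0 i j k l n : mon i.+1 j k l n = (mon i j k l n + U_(i0))%MM.
Proof.
by apply/mnmP => a; rewrite mnmDE !mnmE; case: a => [[|[|[|[|[|//]]]]] ?];
  rewrite /= ?addn0 ?addn1.
Qed.
Lemma monS1 i j k l n : mon i j.+1 k l n = (mon i j k l n + U_(i1))%MM.
Proof.
by apply/mnmP => a; rewrite mnmDE !mnmE; case: a => [[|[|[|[|[|//]]]]] ?];
  rewrite /= ?addn0 ?addn1.
Qed.
Lemma monS2 i j k l n : mon i j k l n.+1 = (mon i j k l n + U_(i2))%MM.
Proof.
by apply/mnmP => a; rewrite mnmDE !mnmE; case: a => [[|[|[|[|[|//]]]]] ?];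
  rewrite /= ?addn0 ?addn1.
Qed.
Lemma monS3 i j k l n : mon i j k.+1 l n = (mon i j k l n + U_(i3))%MM.
Proof.
by apply/mnmP => a; rewrite mnmDE !mnmE; case: a => [[|[|[|[|[|//]]]]] ?];
  rewrite /= ?addn0 ?addn1.
Qed.
Lemma monS4 i j k l n : mon i j k l.+1 n = (mon i j k l n + U_(i4))%MM.
Proof.
by apply/mnmP => a; rewrite mnmDE !mnmE; case: a => [[|[|[|[|[|//]]]]] ?];
  rewrite /= ?addn0 ?addn1.
Qed.

Lemma mdeg_mon i j k l n : mdeg (mon i j k l n) = (i + j + k + l + n)%N.
Proof.
rewrite mdegE !big_ord_recl big_ord0 !mnmE /= addn0.
by rewrite -!addnA; congr (_ + (_ + _))%N; rewrite addnC -!addnA.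
Qed.

Section Uniqueness.
Context (K : numClosedFieldType).
Implicit Types f : {mpoly K[5]}.

(* Coefficientwise, the hypotheses are recursions relating every coefficient to that of
   (x_{e_3} x_{e_{-3}})^N. *)
Lemma so5_invariant_eq0 d f :
  'X_i0 * f^`M(i1) = 'X_i4 * f^`M(i3) ->
  'X_i0 * f^`M(i0) - 'X_i3 * f^`M(i3) = 'X_i1 * f^`M(i1) - 'X_i4 * f^`M(i4) ->
  'X_i1 * f^`M(i2) = 'X_i2 * f^`M(i4) ->
  euler f = d%:R *: f ->
  (forall N, d = N.*2 -> f@_(mon 0 N 0 N 0) = 0) ->
  f = 0.
Proof.
move=> He Hh Hd Heul Htop; pose c i j k l n := f@_(mon i j k l n).
have S0 (x : K) k : x *+ k.+1 = 0 -> x = 0.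
  by move/eqP; rewrite mulrn_eq0 /= => /eqP.
(* The underlying relation is (j+1) c(i,j+1,k,l+1,n) = (k+1) c(i+1,j,k+1,l,n); [e2] and [e3] are its
   boundary cases, where one side has no term. *)
have e1 i j k l n : c i.+1 j k.+1 l n = 0 <-> c i j.+1 k l.+1 n = 0.
  have := congr1 (mcoeff (mon i.+1 j k l.+1 n)) He.
  rewrite {1}monS0 mcoeff_Xderiv (monS4 i.+1) mcoeff_Xderiv -monS1 -monS3 /c.
  set u := f@_ _; set v := f@_ _ => E.
  by split=> z; move: E; rewrite z mul0rn; [move/S0 | move/esym/S0].
have e2 i j k n : c i j.+1 k 0%N n = 0.
  have := congr1 (mcoeff (mon i.+1 j k 0 n)) He.
  by rewrite {1}monS0 mcoeff_Xderiv -monS1 mcoeffXM0 ?mnmE // => /S0.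
have e3 j k l n : c 0%N j k.+1 l n = 0.
  have := congr1 (mcoeff (mon 0 j k l.+1 n)) He.
  by rewrite monS4 mcoeff_Xderiv -monS3 mcoeffXM0 ?mnmE // => /esym /S0.
(* The third equation trades x_{e_0}^2 for x_{e_3} x_{e_{-3}}, so only exponents 0 and 1 of x_{e_0}
   need separate treatment. *)
have d1 i j k l n : c i j.+1 k l.+1 n = 0 -> c i j k l n.+2 = 0.
  have := congr1 (mcoeff (mon i j.+1 k l n.+1)) Hd.
  rewrite {1}monS1 mcoeff_Xderiv (monS2 i j.+1) mcoeff_Xderiv -monS4 -!monS2 /c => E z.
  by move: E; rewrite z mul0rn => /S0.
have d2 i j k l : c i j k l 1%N = 0.
  have := congr1 (mcoeff (mon i j.+1 k l 0)) Hd.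
  by rewrite {1}monS1 mcoeff_Xderiv -monS2 mcoeffXM0 ?mnmE // => /S0.
have h i j k l n : c i j k l n <> 0 -> (i + l = j + k)%N.
  have := congr1 (mcoeff (mon i j k l n)) Hh.
  rewrite !mcoeffB !mcoeff_Xderivv !mnmE /= -/(c i j k l n) => /eqP.
  rewrite subr_eq addrAC eq_sym subr_eq -!mulrnDr eq_sym => /eqP E /eqP z.
  exact: (mulrIn z E).
have lt1 l : forall i j k n, (l < j)%N -> c i j k l n = 0.
  elim: l => [|l IH] i [|j] k n lj //.
  by apply/e1/IH.
have lt2 i : forall j k l n, (i < k)%N -> c i j k l n = 0.
  elim: i => [|i IH] j [|k] l n ik //.
  by apply/e1/IH.
(* By [e1] a factor x_{e_2} x_{e_{-2}} is exchanged for x_{e_3} x_{e_{-3}} until the former is used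
   up; a pure power of the latter then has the wrong degree or is covered by [Htop]. *)
have diag i : forall j, c i j i j 0%N = 0.
  elim: i => [|i IH] j; last exact/e1/IH.
  have [dj|dj] := eqVneq d (j.*2); first exact: Htop.
  have := congr1 (mcoeff (mon 0 j 0 j 0)) Heul.
  rewrite mcoeffZ raddf_sum /=; under eq_bigr do rewrite mcoeff_Xderivv.
  rewrite sumrMnr -mdegE mdeg_mon !addn0 !add0n addnn mulr_natl.
  move=> E; apply/eqP; apply/contraNT: dj => z; exact/eqP/esym/(mulrIn z E).
(* A surviving coefficient satisfies i + l = j + k, j <= l and k <= i, which forces i = k and j =
   l. *)
have n0 i j k l : c i j k l 0%N = 0.
  apply: contrapT => z; have ijkl := h _ _ _ _ _ z.
  case: (ltnP l j) => [/lt1/z //|jl]; case: (ltnP i k) => [/lt2/z //|ki].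
  have E1 : i = k by apply/eqP; rewrite eqn_leq ki andbT -(leq_add2r l) ijkl addnC leq_add2l.
  by apply: z; rewrite E1; move: ijkl; rewrite E1 addnC => /addIn ->; exact: diag.
have all0 n : forall i j k l, c i j k l n = 0.
  elim/ltn_ind: n => [[|[|n]]] IH i j k l //.
  by apply: d1; apply: IH.
by apply/mpolyP => m; rewrite mcoeff0 (mon_eq m); exact: all0.
Qed.
End Uniqueness.

(** * Powers of the invariant quadric *)

Section Quadric.
Context (K : numClosedFieldType) (lam : K).
Implicit Types f : {mpoly K[5]}.
Local Notation P := {mpoly K[5]}.
Local Notation sk := (@sk K).

Lemma sk_mid_entries a b c e : sk (mid a) (mid b) (mid c) (mid e)
  = (c == a)%:R * (e == b)%:R - (c == opp5 b)%:R * (e == opp5 a)%:R.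
Proof. by rewrite skE !negp_mid !mid_eq -!natrM !mulnb. Qed.

Lemma rho_sk_mid a b f :
  rho lam (sk (mid a) (mid b)) f = 'X_a * f^`M(b) - 'X_(opp5 b) * f^`M(opp5 a).
Proof.
have z (c : 'I_5) : (0 == mid c) = false by rewrite eq_sym mid_eq0.
rewrite rhoE /rho_def big1 ?add0r => [|c _]; last first.
  by rewrite skE !negp_mid !z !andbF subrr scale0r.
rewrite skE !negp_mid !z /= subrr scale0r add0r.
rewrite [X in _ + X]big1 ?addr0 => [|c _]; last first.
  by rewrite skE !negp_mid !z /= subrr scale0r.
under eq_bigr do under eq_bigr do rewrite sk_mid_entries scalerBl -!scalerA.
under eq_bigr do rewrite sumrB -!scaler_sumr pick5 (pick5 (fun e => 'X__ * f^`M(e))).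
by rewrite sumrB pick5 (pick5 (fun c => 'X_c * f^`M(opp5 a))).
Qed.

Lemma rho_sk00 f : rho lam (sk 0 0) f = lam *: f - euler f.
Proof.
rewrite rhoE /rho_def big1 ?add0r => [|c _]; last first.
  by rewrite skE !mid_eq0 mid_eq4 subrr scale0r.
rewrite big1 ?addr0 => [|c _]; last first.
  by rewrite big1 // => e _; rewrite skE !mid_eq0 mid_eq4 subrr scale0r.
rewrite big1 ?addr0 => [|c _]; last first.
  by rewrite skE mid_eq0 mid_eq4 !andbF subrr scale0r.
by rewrite skE /= subr0 scale1r.
Qed.

Lemma rho_upper a f : rho lam (sk 0 (mid a)) f = raise lam a f.
Proof.
have z (c : 'I_5) : (0 == mid c) = false by rewrite eq_sym mid_eq0.
rewrite rhoE /rho_def big1 ?add0r => [|c _]; last first.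
  by rewrite skE mid_eq0 andbF subrr scale0r.
rewrite skE z negp_mid z /= subrr scale0r add0r.
rewrite big1 ?add0r => [|c _]; last first.
  by rewrite big1 // => e _; rewrite skE mid_eq0 mid_eq4 andbF subrr scale0r.
rewrite -[RHS](pick5 (fun c => raise lam c f)); apply: eq_bigr => c _.
by rewrite skE mid_eq negp_mid z subr0.
Qed.

Definition quadric : P := \sum_(c < 5) 'X_c * 'X_(opp5 c).
Local Notation Q := quadric.

Lemma mderivQ c : Q^`M(c) = 2 *: 'X_(opp5 c).
Proof.
rewrite /quadric raddf_sum /=.
under eq_bigr => e _.
  rewrite -['X_(opp5 e)]mulr1 mderiv_mulX mderiv_mulX -mpolyC1 mderivC mulr0 addr0.
  rewrite mpolyC1 mulr1 [c == e]eq_sym.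
  have -> : (c == opp5 e) = (e == opp5 c) by rewrite -(inj_eq (can_inj opp5K)) opp5K eq_sym.
  rewrite -scalerAr mulr1.
  over.
rewrite big_split /= (pick5 (fun e => 'X_(opp5 e))) (pick5 (fun e => 'X_e)).
by rewrite -mulr2n scaler_nat.
Qed.

Lemma mderivQX c N :
  (Q ^+ N.+1)^`M(c) = (2 * N.+1%:R) *: ('X_(opp5 c) * Q ^+ N).
Proof.
elim: N => [|N IH]; first by rewrite expr1 expr0 mulr1 mderivQ mulr1.
rewrite exprS mderivM IH mderivQ -!mul_mpolyC !mpolyCM !mpolyC_nat exprS; ring.
Qed.

Lemma eulerQX N : euler (Q ^+ N) = (2 * N%:R) *: Q ^+ N.
Proof.
case: N => [|N].
  rewrite mulr0 scale0r /euler big1 // => c _.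
  by rewrite expr0 -mpolyC1 mderivC mulr0.
rewrite /euler; under eq_bigr do rewrite mderivQX -scalerAr mulrA.
by rewrite -scaler_sumr -mulr_suml -exprS.
Qed.

(** The 5 is the number of variables, from differentiating each x_{-c} by itself; the 2N is the
    Euler eigenvalue of Q^N. *)
Lemma lapQX N : lap (Q ^+ N.+1) = (2 * N.+1%:R * (5 + 2 * N%:R)) *: Q ^+ N.
Proof.
rewrite /lap; under eq_bigr do rewrite mderivQX mderivZ mderiv_mulX eqxx scale1r.
rewrite -scaler_sumr -scalerA; congr (_ *: _).
rewrite big_split /= sumr_const card_ord scalerDl -eulerQX; congr (_ + _).
  by rewrite -scaler_nat.
by rewrite [RHS](reindex_inj (can_inj opp5K)).
Qed.

(** The Euler field contributes the degree 2N+1 of x_{-a} Q^N and half the Laplacian contributes (5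
    + 2N)/2: lambda - (2N+1) + (5+2N)/2 = lambda - (N+1) + 5/2. *)
Lemma raiseQX a N : raise lam a (Q ^+ N.+1) =
  (2 * N.+1%:R * (lam - N.+1%:R + 5 / 2)) *: ('X_(opp5 a) * Q ^+ N).
Proof.
rewrite /raise mderivQX lapQX (linZ (@euler_linear _)) euler_mulX eulerQX.
rewrite -!scalerAr -[X in _ - _ *: (X + _)]scale1r -scalerDl !scalerA.
rewrite -scalerBl -scalerDl; congr (_ *: _).
by field.
Qed.

Lemma Q_neq0 : Q != 0.
Proof.
apply/eqP => Q0; have := mderivQ i0; rewrite Q0 mderiv0 => /esym/eqP.
rewrite scaler_eq0 pnatr_eq0 /= => /eqP/(congr1 (mcoeff U_(opp5 i0))).
by rewrite mcoeffX eqxx mcoeff0 => /eqP; rewrite oner_eq0.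
Qed.

Lemma QX_neq0 N : Q ^+ N != 0.
Proof. exact: expf_neq0 Q_neq0. Qed.

Lemma rho_kills1_QX x N : kills1 x -> lam = N%:R - 5 / 2 ->
  rho lam x (Q ^+ N) = 0.
Proof.
case: N => [|N] [x0 xa] lamN; first by rewrite expr0 rho_kills1.
rewrite rhoE /rho_def x0 scale0r addr0 big1 ?add0r => [|a _]; last first.
  by rewrite xa scale0r.
rewrite [X in _ + X]big1 ?addr0 => [|a _]; last first.
  have E : lam - N.+1%:R + 5 / 2 = 0 by rewrite lamN; ring.
  by rewrite raiseQX E mulr0 scale0r scaler0.
set S := (X in X = 0).
(* Under (a, b) -> (-b, -a) the matrix entry changes sign, while x_a d_b Q^(N+1) is proportional to
   x_a x_{-b} Q^N and is unchanged. *)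
suff E : S = - S.
  by apply/eqP; move/eqP: E; rewrite -addr_eq0 -mulr2n -scaler_nat scaler_eq0 pnatr_eq0.
rewrite {1}/S (reindex_inj (can_inj opp5K)) exchange_big (reindex_inj (can_inj opp5K)) /=.
rewrite /S -sumrN; apply: eq_bigr => a _; rewrite -sumrN; apply: eq_bigr => b _.
rewrite so7_entry !negp_mid !opp5K scaleNr; congr (- (_ *: _)).
by rewrite !mderivQX -!scalerAr !opp5K mulrCA.
Qed.

Lemma rho_QX_raise N g : g != 0 ->
  rho lam (gsub K 1 2) (g *: Q ^+ N.+1) = 0 -> lam = N.+1%:R - 5 / 2.
Proof.
move=> g0; have -> : gsub K 1 2 = sk 0 (mid i0) by congr (sk _ _); exact/val_inj.
rewrite (linZ (rho_linear lam _)) rho_upper raiseQX => /eqP.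
rewrite !scaler_eq0 (negPf g0) /= !mulf_eq0 (negPf (QX_neq0 N)) !pnatr_eq0 orbF /=.
case/orP => [/eqP E|/eqP/(congr1 (mcoeff U_(opp5 i0)))]; last first.
  by rewrite mcoeffX eqxx mcoeff0 => /eqP; rewrite oner_eq0.
by apply/eqP; rewrite -subr_eq0 opprB addrA addrAC E.
Qed.

(** Both [f] and Q^N satisfy the recursions, so subtracting the multiple of Q^N with the same
    coefficient of (x_{e_3} x_{e_{-3}})^N leaves 0 by [so5_invariant_eq0]. *)
Lemma so5_invariant d f :
  rho lam (gsub K 2 3) f = 0 -> rho lam (hcart K 2 - hcart K 3) f = 0 ->
  rho lam (gshort K 3) f = 0 -> rho lam (hcart K 1) f = (lam - d%:R) *: f ->
  f = 0 \/ exists N, d = N.*2 /\ exists g, f = g *: Q ^+ N.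
Proof.
have -> : gsub K 2 3 = sk (mid i0) (mid i1) by congr (sk _ _); exact/val_inj.
have -> : hcart K 2 = sk (mid i0) (mid i0) by congr (sk _ _); exact/val_inj.
have -> : hcart K 3 = sk (mid i1) (mid i1) by congr (sk _ _); exact/val_inj.
have -> : hcart K 1 = sk 0 0 by congr (sk _ _); exact/val_inj.
have -> : gshort K 3 = sqrtC 2 *: sk (mid i1) (mid i2).
  by congr (_ *: sk _ _); exact/val_inj.
rewrite (linB (rho_linearl lam f)) (linZ (rho_linearl lam f)) !rho_sk_mid rho_sk00.
have -> : opp5 i0 = i3 by exact/val_inj.
have -> : opp5 i1 = i4 by exact/val_inj.
have -> : opp5 i2 = i2 by exact/val_inj.
move=> /eqP; rewrite subr_eq0 => /eqP He /eqP; rewrite subr_eq0 => /eqP Hh.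
move=> /eqP; rewrite scaler_eq0 (negPf (@sqrt2_neq0 K)) subr_eq0 => /eqP Hd.
rewrite scalerBl => /addrI/oppr_inj Heul.
have inv N : [/\ 'X_i0 * (Q ^+ N)^`M(i1) = 'X_i4 * (Q ^+ N)^`M(i3),
    'X_i0 * (Q ^+ N)^`M(i0) - 'X_i3 * (Q ^+ N)^`M(i3)
      = 'X_i1 * (Q ^+ N)^`M(i1) - 'X_i4 * (Q ^+ N)^`M(i4)
    & 'X_i1 * (Q ^+ N)^`M(i2) = 'X_i2 * (Q ^+ N)^`M(i4)].
  case: N => [|N]; first by rewrite expr0 -mpolyC1 !mderivC !mulr0 subrr.
  rewrite !mderivQX.
  have -> : opp5 i0 = i3 by exact/val_inj.
  have -> : opp5 i1 = i4 by exact/val_inj.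
  have -> : opp5 i2 = i2 by exact/val_inj.
  have -> : opp5 i3 = i0 by exact/val_inj.
  have -> : opp5 i4 = i1 by exact/val_inj.
  by split; rewrite -!mul_mpolyC; ring.
have [[N dN]|odd_d] := pselect (exists N, d = N.*2); last first.
  left; apply: (so5_invariant_eq0 He Hh Hd Heul) => N dN.
  by case: odd_d; exists N.
right; exists N; split=> //.
pose t := (Q ^+ N)@_(mon 0 N 0 N 0); pose g := f@_(mon 0 N 0 N 0) / t.
have [Q1 Q2 Q3] := inv N.
have eQ : euler (Q ^+ N) = d%:R *: Q ^+ N by rewrite eulerQX dN -mul2n natrM.
(* The coefficient [t] need not be computed: if it vanished, the uniqueness lemma applied to Q^N
   itself would give Q^N = 0. *)
have t0 : t != 0.
  apply/eqP => t0; have /eqP := QX_neq0 N; apply.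
  by apply: (so5_invariant_eq0 Q1 Q2 Q3 eQ) => M; rewrite dN => /double_inj <-.
exists g; apply/eqP; rewrite -subr_eq0; apply/eqP.
apply: (@so5_invariant_eq0 _ d).
- by rewrite !mderivB !mderivZ !mulrBr He -!scalerAr Q1.
- rewrite !mderivB !mderivZ -!mul_mpolyC.
  have comb (G a b u v w z : P) :
      a * (u - G * w) - b * (v - G * z) = (a * u - b * v) - G * (a * w - b * z) by ring.
  by rewrite !comb Hh Q2.
- by rewrite !mderivB !mderivZ !mulrBr Hd -!scalerAr Q3.
- by rewrite (linB (@euler_linear _)) (linZ (@euler_linear _)) Heul eQ -!mul_mpolyC; ring.
move=> M; rewrite dN => /double_inj <-.
by rewrite mcoeffB mcoeffZ -/t mulfVK // subrr.
Qed.
End Quadric.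

(** * The subalgebra i(Lie G_2) *)

Section G2.
Context (K : numClosedFieldType).
Implicit Types x y h : so7 K.
Implicit Types u v w : 'I_7 -> K.
Local Notation sk := (@sk K).

Definition vact x u : 'I_7 -> K := fun i => \sum_j x i j * u j.

Definition det3 (i j k : 'I_7) u v w : K :=
  u i * (v j * w k - v k * w j) - u j * (v i * w k - v k * w i)
  + u k * (v i * w j - v j * w i).

(* The G_2-invariant 3-form B(u x v, w), with u x v the octonionic cross product. *)
Definition phi u v w : K :=
  sqrtC 2 * (det3 (pos 1) (pos (-2)) (pos (-3)) u v w
             - det3 (pos 2) (pos 3) (pos (-1)) u v w)
  - det3 (pos 0) (pos 1) (pos (-1)) u v w
  + det3 (pos 0) (pos 2) (pos (-2)) u v w
  + det3 (pos 0) (pos 3) (pos (-3)) u v w.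

Definition phi_der x u v w : K :=
  phi (vact x u) v w + phi u (vact x v) w + phi u v (vact x w).

(** As [lie_gen] is an intersection, any subalgebra containing the generators bounds i(Lie G_2) from
    above; the stabiliser of [phi] serves as that bound. *)
Definition phi_invariant : set (so7 K) :=
  [set x | forall u v w, phi_der x u v w = 0]%classic.

Lemma vact_linear a x y u i :
  vact (a *: x + y) u i = a * vact x u i + vact y u i.
Proof.
rewrite /vact mulr_sumr -big_split; apply: eq_bigr => j _ /=.
by rewrite !mxE mulrDl mulrA.
Qed.

Lemma vact_lie x y u i :
  vact (lie x y) u i = vact x (vact y u) i - vact y (vact x u) i.
Proof.
have E z t : vact z (vact t u) i = \sum_j (\sum_k z i k * t k j) * u j.
  rewrite /vact; under eq_bigr do rewrite mulr_sumr.
  rewrite exchange_big; apply: eq_bigr => j _; rewrite mulr_suml.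
  by apply: eq_bigr => k _; rewrite mulrA.
by rewrite !E -sumrB; apply: eq_bigr => j _; rewrite so7_lieE mulrBl.
Qed.

Lemma phi_invariant_subalg : lie_subalg phi_invariant.
Proof.
split=> [|x y Wx Wy u v w]; first split=> [u v w|a x y Wx Wy u v w].
- have z t i : vact 0 t i = 0.
    by rewrite /vact big1 // => j _; rewrite mxE mul0r.
  by rewrite /phi_der /phi /det3 !z; ring.
- have -> : phi_der (a *: x + y) u v w = a * phi_der x u v w + phi_der y u v w.
    rewrite /phi_der /phi /det3 !vact_linear; ring.
  by rewrite Wx Wy mulr0 addr0.
(* The derivation attached to a bracket is the commutator of the two derivations; terms in which x
   and y act on different arguments cancel. *)
have -> : phi_der (lie x y) u v w =
    phi_der x (vact y u) v w + phi_der x u (vact y v) w + phi_der x u v (vact y w)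
    - phi_der y (vact x u) v w - phi_der y u (vact x v) w - phi_der y u v (vact x w).
  rewrite /phi_der /phi /det3 !vact_lie; ring.
by rewrite !Wx !Wy; ring.
Qed.

Lemma vact_sk i j u k :
  vact (sk i j) u k = (k == i)%:R * u j - (k == negp j)%:R * u (negp i).
Proof.
rewrite /vact; under eq_bigr do rewrite skE mulrBl -!mulnb !natrM -!mulrA.
have pick (F : 'I_7 -> K) k0 : \sum_k (k == k0)%:R * F k = F k0.
  by rewrite (bigD1 k0) //= eqxx mul1r big1 ?addr0 // => c /negPf ->; rewrite mul0r.
by rewrite sumrB -!mulr_sumr !pick.
Qed.

Lemma sqrt2K : sqrtC 2 * sqrtC 2 = 2 :> K.
Proof. by rewrite -expr2 sqrtCK. Qed.

Lemma vactZ a x u i : vact (a *: x) u i = a * vact x u i.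
Proof. by rewrite /vact mulr_sumr; apply: eq_bigr => j _; rewrite mxE mulrA. Qed.

Lemma vactD x y u i : vact (x + y) u i = vact x u i + vact y u i.
Proof. by rewrite /vact -big_split; apply: eq_bigr => j _ /=; rewrite mxE mulrDl. Qed.

Lemma phi_invariant_gens : (@g2_gens K `<=` phi_invariant)%classic.
Proof.
have E (k l : 'I_7) : (k == l) = (val k == val l) by [].
move=> x; rewrite /g2_gens /= !inE => /or4P[] /eqP -> u v w; rewrite /phi_der /phi /det3.
- rewrite -[gsub _ _ _]/(sk _ _) !vact_sk !E /=; ring.
- rewrite -[gsub _ _ _]/(sk _ _) !vact_sk !E /=; ring.
- rewrite -[gsub _ _ _]/(sk _ _) -[gshort _ _]/(sqrtC 2 *: sk _ _).
  rewrite !vactD !vactZ !vact_sk !E /=; move: (sqrtC 2) sqrt2K => s s2.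
  ring: s2.
- rewrite -[gsub _ _ _]/(sk _ _) -[gshortN _ _]/(sqrtC 2 *: sk _ _).
  rewrite !vactD !vactZ !vact_sk !E /=; move: (sqrtC 2) sqrt2K => s s2.
  ring: s2.
Qed.

Lemma g2_phi_invariant x : g2 x -> phi_invariant x.
Proof. by apply; [exact: phi_invariant_subalg | exact: phi_invariant_gens]. Qed.

(** The 3-form has a term in the coordinates of e_2, e_3, e_{-1} with nonzero coefficient, and a
    diagonal element scales it by eps_2 + eps_3 - eps_1, which invariance forces to vanish. *)
Lemma g2_cartan_eps h : g2_cartan h -> eps 1 h = eps 2 h + eps 3 h.
Proof.
move=> [/g2_phi_invariant ph /cartan_diag dh].
pose e k : 'I_7 -> K := fun i => (i == pos k)%:R.
have vE k i : vact h (e k) i = h (pos k) (pos k) * e k i.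
  rewrite /vact (bigD1 (pos k)) //= big1 => [|j /negPf jk]; last by rewrite /e jk mulr0.
  rewrite /e eqxx mulr1 addr0; case: eqP => [->|/eqP ik]; first by rewrite mulr1.
  by rewrite dh // mulr0.
have E (k l : 'I_7) : (k == l) = (val k == val l) by [].
have := ph (e 2) (e 3) (e (-1)); rewrite /phi_der /phi /det3 !vE /e !E /=.
have -> : h (pos (-1)) (pos (-1)) = - h (pos 1) (pos 1).
  by rewrite so7_entry; congr (- so7_mx _ _ _); exact/val_inj.
rewrite -/(eps 1 h) -/(eps 2 h) -/(eps 3 h) => P0.
have /eqP : sqrtC 2 * (eps 1 h - (eps 2 h + eps 3 h)) = 0.
  by rewrite -[RHS]P0; ring.
by rewrite mulf_eq0 (negPf (@sqrt2_neq0 K)) subr_eq0 => /eqP.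
Qed.

Definition g2_simple : so7 K := gsub K 1 2 + gshort K 3.

(** The two summands have so(7)-weights eps_1 - eps_2 and eps_3, which coincide on i(h') by
    [g2_cartan_eps]. *)
Lemma g2_simple_root : g2_root_space 1 0 g2_simple.
Proof.
split=> [W _ gW|h hg2]; first by apply: gW; rewrite /g2_gens /= !inE eqxx !orbT.
have [_ /cartan_diag dh] := hg2.
rewrite (linD (lie_linearr h)) (linZ (lie_linearr h)) !lie_diag_sk // /alpha1.
rewrite mul1r mul0r addr0 scalerDr scalerA mulrC -scalerA; congr (_ + _).
have n0 : negp (pos 0) = pos 0 by exact/val_inj.
have := so7_entry_anti h (pos 0); rewrite n0 => ->; rewrite subr0.
congr (_ *: (_ *: sk _ _)).
by apply/eqP; rewrite eq_sym subr_eq addrC; apply/eqP; exact: g2_cartan_eps.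
Qed.

Lemma g2_simple_nilrad : g2_nilrad g2_simple.
Proof.
apply: sub_lspan; exists 1%N, 0%N; split=> //; last exact: g2_simple_root.
split=> //; exists g2_simple; first exact: g2_simple_root.
move/(congr1 (fun x : so7 K => x (pos 1) (pos 2))).
rewrite so7_DE so7_ZE !skE -!val_eqE /= mxE => /eqP.
by rewrite subr0 subrr mulr0 addr0 oner_eq0.
Qed.

Lemma lie_sk i j k l : lie (sk i j) (sk k l) =
  (j == k)%:R *: sk i l - (i == l)%:R *: sk k j
  - (j == negp l)%:R *: sk i (negp k) - (negp i == k)%:R *: sk (negp j) l.
Proof.
have e1 : (l == i) = (i == l) by rewrite eq_sym.
have e2 : (negp i == negp l) = (i == l) by rewrite (inj_eq (can_inj negpK)).
have e3 : (negp k == negp j) = (j == k) by rewrite (inj_eq (can_inj negpK)) eq_sym.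
have e4 : (l == negp j) = (j == negp l) by rewrite -(inj_eq (can_inj negpK)) negpK eq_sym.
have e5 : (negp k == i) = (negp i == k) by rewrite -(inj_eq (can_inj negpK)) negpK eq_sym.
apply/val_inj => /=.
rewrite /skew_unit_mx !mulmxBl !mulmxBr !mul_delta_mx_cond !negpK e1 e2 e3 e4 e5.
apply/matrixP => a b; rewrite !(mulmxnE, mxE); ring.
Qed.

Lemma lie_gen_subalg (A : set (so7 K)) : lie_subalg (lie_gen A).
Proof.
split=> [|x y Ax Ay W sW AW]; last by apply: sW.2; [exact: Ax | exact: Ay].
split=> [W sW _|a x y Ax Ay W sW AW]; first exact: sW.1.1.
by apply: sW.1.2; [exact: Ax | exact: Ay].
Qed.

(** The fundamental coweight with alpha_1 = 1 and alpha_2 = 0: the grading element of the parabolic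
    subalgebra, with l' in degree 0. The companion [h_long] is the coroot of alpha_2. *)
Definition h_short : so7 K := 2 *: hcart K 1 + hcart K 2 + hcart K 3.
Definition h_long : so7 K := hcart K 2 - hcart K 3.

Lemma lie_g23 : lie (gsub K 2 3) (gsub K 3 2) = h_long.
Proof.
have E (k l : 'I_7) : (k == l) = (val k == val l) by [].
by rewrite [LHS]lie_sk !E /= !scale1r !scale0r !subr0.
Qed.

Lemma lie_g2_simple : lie g2_simple (gsub K 2 1 + gshortN K 3) =
  hcart K 1 - hcart K 2 + 2 *: hcart K 3.
Proof.
have E (k l : 'I_7) : (k == l) = (val k == val l) by [].
rewrite (linD (lie_linearr _)) (linZ (lie_linearr _)).
rewrite !(linD (lie_linearl _)) !(linZ (lie_linearl _)).
have -> : lie (gsub K 1 2) (gsub K 2 1) = hcart K 1 - hcart K 2.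
  by rewrite [LHS]lie_sk !E /= !scale1r !scale0r !subr0.
have -> : lie (gsub K 1 2) (skew_unit K 0 3) = 0.
  by rewrite [LHS]lie_sk !E /= !scale0r !subr0.
have -> : lie (skew_unit K 3 0) (gsub K 2 1) = 0.
  by rewrite [LHS]lie_sk !E /= !scale0r !subr0.
have -> : lie (skew_unit K 3 0) (skew_unit K 0 3) = hcart K 3.
  rewrite [LHS]lie_sk !E /= !scale1r !scale0r !subr0.
  have -> : sk (pos 0) (pos 0) = sk (pos 0) (negp (pos 0)).
    by congr (sk _ _); exact/val_inj.
  by rewrite sk0 subr0.
by rewrite scaler0 addr0 add0r scalerA sqrt2K.
Qed.

Lemma g2_gens_g2 x : x \in [:: gsub K 2 3; gsub K 3 2;
  gsub K 1 2 + gshort K 3; gsub K 2 1 + gshortN K 3] -> g2 x.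
Proof. by move=> xin W _; apply. Qed.

Lemma h_long_g2_cartan : g2_cartan h_long.
Proof.
have cs := lspan_subspace [set x | x \in [:: hcart K 1; hcart K 2; hcart K 3]]%classic.
split.
  rewrite -lie_g23; apply: (lie_gen_subalg _).2; apply: g2_gens_g2;
  by rewrite !inE eqxx ?orbT.
by apply: (subspaceD cs); [|apply: (subspaceN cs)];
  apply: sub_lspan; rewrite /= !inE eqxx ?orbT.
Qed.

Lemma h_short_g2_cartan : g2_cartan h_short.
Proof.
have cs := lspan_subspace [set x | x \in [:: hcart K 1; hcart K 2; hcart K 3]]%classic.
have gs := (lie_gen_subalg (@g2_gens K)).1.
split.
  (* The bracket is the coroot of alpha_1, and in G_2 the coweight is twice that coroot plus three
     times the coroot of alpha_2. *)
  have -> : h_short = 2 *: lie g2_simple (gsub K 2 1 + gshortN K 3) + 3 *: h_long.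
    rewrite lie_g2_simple /h_short /h_long.
    by apply/val_inj/matrixP => i j; rewrite !(so7_DE, so7_ZE, mxE) /=; ring.
  apply: gs.2; last by apply: (subspaceZ _ gs); exact: h_long_g2_cartan.1.
  by apply: (lie_gen_subalg _).2; apply: g2_gens_g2; rewrite !inE eqxx ?orbT.
by apply: (subspaceD cs); [apply: (subspaceD cs); [apply: (subspaceZ _ cs)|]|];
  apply: sub_lspan; rewrite /= !inE eqxx ?orbT.
Qed.

(** A root vector for a alpha_1 + b alpha_2 has degree a >= 0 under [h_short], while the entries
    leading from e_1 to a middle vector have negative degree. The entry at (e_1, e_1) has weight 0,
    which [h_short] and [h_long] together exclude for (a, b) <> (0, 0). *)
Lemma g2_nilrad_kills1 x : g2_nilrad x -> kills1 x.
Proof.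
apply: lspan_min; first exact: kills1_subspace.
move=> {}x [a [b [[ab0 _] _ [_ wx]]]].
have [_ /cartan_diag ds] := h_short_g2_cartan.
have [_ /cartan_diag dl] := h_long_g2_cartan.
have entry h i j : g2_cartan h -> so7_diag h ->
    (h i i - h j j) * x i j = (a%:R * alpha1 h + b%:R * alpha2 h) * x i j.
  by move=> gh dh; rewrite -lie_diagE // wx // so7_ZE.
have a1s : alpha1 h_short = 1 by rewrite /alpha1 /eps /= !mxE -!val_eqE /=; ring.
have a2s : alpha2 h_short = 0 by rewrite /alpha2 /eps /= !mxE -!val_eqE /=; ring.
have a1l : alpha1 h_long = -1 by rewrite /alpha1 /eps /= !mxE -!val_eqE /=; ring.
have a2l : alpha2 h_long = 2 by rewrite /alpha2 /eps /= !mxE -!val_eqE /=; ring.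
have cancel (n : nat) (c : K) : n.+1%:R * c = 0 -> c = 0.
  by move/eqP; rewrite mulf_eq0 pnatr_eq0 => /eqP.
split=> [|c].
  have := entry _ 0 0 h_short_g2_cartan ds; have := entry _ 0 0 h_long_g2_cartan dl.
  rewrite !subrr !mul0r a1s a2s a1l a2l mulr1 mulr0 addr0.
  case: a ab0 {wx entry} => [ab0|a _ _] E; last by apply: (cancel a); rewrite -E.
  case: b ab0 E => [|b _]; first by case.
  rewrite mul0r add0r mulrAC mulrC => /esym E _; apply: (cancel b).
  by apply: (cancel 1%N).
(* The eigenvalues of [h_short] are 1, 1, 0, -1, -1 on the middle vectors, against 2 on e_1. *)
have [n hn] : exists n : nat, h_short (mid c) (mid c) - h_short 0 0 = - n.+1%:R.
  case: c => [[|[|[|[|[|//]]]]] ?];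
    [exists 0%N|exists 0%N|exists 1%N|exists 2%N|exists 2%N];
    rewrite /= !mxE -!val_eqE /=; ring.
have := entry _ (mid c) 0 h_short_g2_cartan ds; rewrite hn a1s a2s mulr1 mulr0 addr0.
move=> E; apply: (cancel (n + a)%N).
rewrite -addSn natrD mulrDl -E; ring.
Qed.

Lemma g2_levi_ss_kills1 x : g2_levi_ss x -> kills1 x.
Proof.
apply: lspan_min; first exact: kills1_subspace.
move=> {}x /=; rewrite !inE => /or3P[] /eqP->; split=> [|a];
  try case: a => [[|[|[|[|[|//]]]]] ?];
  rewrite /= !mxE -?val_eqE /= ?subrr ?subr0 ?mulr0 ?addr0 ?oppr0 //.
Qed.
End G2.

(** * Singular vectors *)

Section Singular.
Context (K : numClosedFieldType) (lam : K).
Implicit Types (x y h : so7 K) (v : verma lam) (f : {mpoly K[5]}).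
Local Notation P := {mpoly K[5]}.
Local Notation sk := (@sk K).
Local Notation hw := (verma_hw lam).
Local Notation act := (verma_act lam).
Local Notation rho := (rho lam).
Local Notation Q := (quadric K).

Definition Phi : verma lam -> P := sval (cid (verma_iso lam)).

Lemma Phi_linear : linear Phi.
Proof. by have [[]] := svalP (cid (verma_iso lam)). Qed.

Lemma Phi_inj : injective Phi.
Proof. by have [[_ /can_inj]] := svalP (cid (verma_iso lam)). Qed.

Lemma Phi_act x v : Phi (act (env_in x) v) = rho x (Phi v).
Proof. by have [_] := svalP (cid (verma_iso lam)); exact. Qed.

Lemma Phi_hw : Phi hw = 1.
Proof.
have [[_ _ PsiK] _] := svalP (cid (verma_iso lam)).
by rewrite -(Psi1 lam); exact: PsiK.
Qed.

Lemma Phi_eq0 v : Phi v = 0 -> v = 0.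
Proof. by move=> v0; apply: Phi_inj; rewrite v0 (lin0 Phi_linear). Qed.

Definition acts_as (u : envel (so7 K)) (U : P) := forall v, Phi (act u v) = U * Phi v.

Lemma acts_as1 : acts_as 1 1.
Proof. by move=> v; rewrite /verma_act ind_act1 mul1r. Qed.

Lemma acts_asM u w U W : acts_as u U -> acts_as w W -> acts_as (u * w) (U * W).
Proof. by move=> uU wW v; rewrite /verma_act ind_actM uU wW mulrA. Qed.

Lemma acts_asX u U n : acts_as u U -> acts_as (u ^+ n) (U ^+ n).
Proof.
move=> uU; elim: n => [|n IH]; first exact: acts_as1.
by rewrite !exprS; exact: acts_asM.
Qed.

Lemma acts_asD u w U W : acts_as u U -> acts_as w W -> acts_as (u + w) (U + W).
Proof.
move=> uU wW v.
by rewrite [act _ _](linD (ind_act_linearl v)) (linD Phi_linear) uU wW mulrDl.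
Qed.

Lemma acts_asZ a u U : acts_as u U -> acts_as (a *: u) (a *: U).
Proof.
move=> uU v.
by rewrite [act _ _](linZ (ind_act_linearl v)) (linZ Phi_linear) uU scalerAl.
Qed.

Lemma acts_as_sum n (F : 'I_n -> envel (so7 K)) (G : 'I_n -> P) :
  (forall i, acts_as (F i) (G i)) -> acts_as (\sum_i F i) (\sum_i G i).
Proof.
move=> FG; elim/big_rec2: _ => [v|i U u _]; last exact: acts_asD.
by rewrite [act _ _](lin0 (ind_act_linearl v)) (lin0 Phi_linear) mul0r.
Qed.

Lemma acts_as_lower a : acts_as (env_in (lower K a)) 'X_a.
Proof. by move=> v; rewrite Phi_act rho_lower. Qed.

Definition U1 : P := 'X_i0 * 'X_i3 + 'X_i4 * 'X_i1.
(** The 2 is the square of the factor sqrt 2 in g_{-eps_1}. *)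
Definition U2 : P := 2 *: 'X_i2 ^+ 2.

Lemma gsub21 : gsub K 2 1 = lower K i0.
Proof. by congr (sk _ _); exact/val_inj. Qed.
Lemma gsub31 : gsub K 3 1 = lower K i1.
Proof. by congr (sk _ _); exact/val_inj. Qed.
Lemma gaddN12 : gaddN K 1 2 = lower K i3.
Proof. by congr (sk _ _); exact/val_inj. Qed.
Lemma gaddN13 : gaddN K 1 3 = lower K i4.
Proof. by congr (sk _ _); exact/val_inj. Qed.
Lemma gshortN1 : gshortN K 1 = sqrtC 2 *: lower K i2.
Proof. by congr (_ *: sk _ _); exact/val_inj. Qed.

Lemma acts_as_u1 : acts_as u1 U1.
Proof.
rewrite /u1 gsub21 gsub31 gaddN12 gaddN13.
by apply: acts_asD; apply: acts_asM; exact: acts_as_lower.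
Qed.

Lemma acts_as_u2 : acts_as u2 U2.
Proof.
have -> : U2 = (sqrtC 2 *: 'X_i2) ^+ 2 by rewrite exprZn sqrtCK.
apply: acts_asX; rewrite gshortN1 (linZ (@env_in_linear _ _)).
exact/acts_asZ/acts_as_lower.
Qed.

Lemma sum5 (V : nmodType) (F : 'I_5 -> V) :
  \sum_c F c = F i0 + F i1 + F i2 + F i3 + F i4.
Proof.
rewrite !big_ord_recl big_ord0 addr0 !addrA.
by do 4?[congr (_ + _)]; congr F; exact/val_inj.
Qed.

Lemma U12Q : 4 *: U1 + U2 = 2 *: Q.
Proof.
rewrite /quadric sum5.
have -> : opp5 i0 = i3 by exact/val_inj.
have -> : opp5 i1 = i4 by exact/val_inj.
have -> : opp5 i2 = i2 by exact/val_inj.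
have -> : opp5 i3 = i0 by exact/val_inj.
have -> : opp5 i4 = i1 by exact/val_inj.
by rewrite /U1 /U2 -!mul_mpolyC !mpolyC_nat; ring.
Qed.

Lemma Phi_power N : Phi (act ((4 *: u1 + u2) ^+ N) hw) = 2 ^+ N *: Q ^+ N.
Proof.
have -> := acts_asX N (acts_asD (acts_asZ 4 acts_as_u1) acts_as_u2) hw.
by rewrite U12Q Phi_hw mulr1 exprZn.
Qed.

Lemma hcart1E : hcart K 1 = sk 0 0.
Proof. by congr (sk _ _); exact/val_inj. Qed.

(** Serves both notions of singularity, since n, [l, l], n' and [l', l'] all lie in [kills1]. A
    Cartan element differs from a multiple of h_{eps_1} by an element of [kills1], which gives the
    weight. *)
Lemma power_singular N c v : lam = N%:R - 5 / 2 -> c != 0 ->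
  v = c *: act ((4 *: u1 + u2) ^+ N) hw ->
  [/\ v <> 0,
      forall x, kills1 x -> act (env_in x) v = 0 &
      forall h, cartan h -> act (env_in h) v = ((lam - (2 * N)%:R) * eps 1 h) *: v].
Proof.
move=> lamN c0 vE.
have PhiE : Phi v = (c * 2 ^+ N) *: Q ^+ N.
  by rewrite vE (linZ Phi_linear) Phi_power scalerA.
have k0 x : kills1 x -> rho x (Phi v) = 0.
  by move=> kx; rewrite PhiE (linZ (rho_linear lam x)) rho_kills1_QX // scaler0.
split=> [v0|x kx|h ch].
- move: PhiE; rewrite v0 (lin0 Phi_linear) => /esym/eqP.
  by rewrite scaler_eq0 mulf_eq0 (negPf c0) expf_eq0 pnatr_eq0 andbF (negPf (QX_neq0 _ _)).
- by apply: Phi_eq0; rewrite Phi_act k0.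
apply: Phi_inj; rewrite Phi_act (linZ Phi_linear).
have kh : kills1 (h - h 0 0 *: hcart K 1).
  rewrite hcart1E -scaleN1r addrC; split=> [|a]; rewrite so7_DE so7_ZE so7_ZE skE ?mid_eq0.
    by rewrite /= subr0; ring.
  by rewrite (cartan_block ch a).1 mid_eq4 subrr mulr0 mulr0 addr0.
have -> : rho h (Phi v) =
    rho (h - h 0 0 *: hcart K 1) (Phi v) + h 0 0 *: rho (hcart K 1) (Phi v).
  by rewrite -(linZ (rho_linearl lam _)) -(linD (rho_linearl lam _)) subrK.
rewrite k0 // add0r PhiE (linZ (rho_linear lam _)) hcart1E rho_sk00 eulerQX -scalerBl.
rewrite !scalerA; congr (_ *: _); rewrite natrM /eps (_ : pos 1 = 0); last exact/val_inj.
ring.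
Qed.

(** The common core of the G_2 and so(7) cases. For N = 0 the vector is proportional to v_lambda and
    lambda is unconstrained, hence the guard on the value of lambda. *)
Lemma invariant_power d v :
  act (env_in (gsub K 2 3)) v = 0 -> act (env_in (hcart K 2 - hcart K 3)) v = 0 ->
  act (env_in (gshort K 3)) v = 0 -> act (env_in (gsub K 1 2)) v = 0 ->
  act (env_in (hcart K 1)) v = (lam - d%:R) *: v -> v <> 0 ->
  exists N, [/\ d = N.*2, (0 < N)%N -> lam = N%:R - 5 / 2
    & exists2 c, c != 0 & v = c *: act ((4 *: u1 + u2) ^+ N) hw].
Proof.
move=> /(congr1 Phi) e1 /(congr1 Phi) e2 /(congr1 Phi) e3 /(congr1 Phi) e4 /(congr1 Phi) e5 v0.
move: e1 e2 e3 e4 e5; rewrite !Phi_act (linZ Phi_linear) (lin0 Phi_linear) => e1 e2 e3 e4 e5.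
have [/Phi_eq0//|[N [dN [g fE]]]] := so5_invariant e1 e2 e3 e5.
have g0 : g != 0.
  by apply/eqP => g0; apply: v0; apply: Phi_eq0; rewrite fE g0 scale0r.
exists N; split=> //.
  by case: N dN fE => // N _ fE _; apply: rho_QX_raise g0 _; rewrite -fE.
have t0 : 2 ^+ N != 0 :> K by rewrite expf_neq0 ?pnatr_eq0.
exists (g / 2 ^+ N); first by rewrite mulf_neq0 ?invr_eq0.
apply: Phi_inj; rewrite (linZ Phi_linear) Phi_power scalerA divfK //.
Qed.

Lemma lin_form_euler (c : 'I_5 -> K) f :
  euler ((\sum_a c a *: 'X_a) * f) =
  (\sum_a c a *: 'X_a) * f + (\sum_a c a *: 'X_a) * euler f.
Proof.
rewrite !mulr_suml (lin_sum (@euler_linear K)) -big_split; apply: eq_bigr => a _ /=.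
by rewrite -scalerAl (linZ (@euler_linear K)) euler_mulX scalerDr scalerAl scalerAl.
Qed.

Lemma rho_nilradN y f : nilradN y -> rho y f = (\sum_a y (mid a) 0 *: 'X_a) * f.
Proof.
move=> ny; pose R y := rho y f = (\sum_a y (mid a) 0 *: 'X_a) * f.
pose W : set (so7 K) := R; suff : W y by [].
apply: (ny W).
  split=> [|k x z Wx Wz]; rewrite /W /R.
    rewrite (lin0 (rho_linearl lam f)) big1 ?mul0r // => a _.
    by rewrite mxE scale0r.
  rewrite rho_linearl Wx Wz scalerAl -mulrDl scaler_sumr -big_split; congr (_ * _).
  by apply: eq_bigr => a _; rewrite so7_DE so7_ZE scalerDl -scalerA.
have Wl a : W (lower K a).
  rewrite /W /R rho_lower -(pick5 (fun c => 'X_c)); congr (_ * _).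
  by apply: eq_bigr => c _; rewrite lowerE mid_eq mid_eq4 eqxx mulr1 mul0r subr0.
have WZ a : W (sqrtC 2 *: lower K a).
  rewrite /W /R (linZ (rho_linearl lam f)) Wl scalerAl scaler_sumr; congr (_ * _).
  by apply: eq_bigr => c _; rewrite so7_ZE scalerA.
move=> x /=; rewrite !inE gsub21 gsub31 gaddN12 gaddN13 gshortN1.
by do ![case/orP]; move/eqP->.
Qed.

Lemma homogeneity_euler d v : homogeneity d v -> euler (Phi v) = d%:R *: Phi v.
Proof.
case=> q Sq ->.
pose W := [set q | euler (Phi (act q hw)) = d%:R *: Phi (act q hw)]%classic.
suff : W q by []. apply: (Sq W).
  split=> [|k x z /= Wx Wz]; rewrite /W /=.
    rewrite [act _ _](lin0 (ind_act_linearl hw)) (lin0 Phi_linear).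
    by rewrite (lin0 (@euler_linear K)) scaler0.
  rewrite [act _ _](ind_act_linearl hw) Phi_linear euler_linear Wx Wz.
  by rewrite scalerDr !scalerA mulrC.
move=> _ [y ny ->]; rewrite /W /= -[in d%:R](card_ord d) -sum1_card natr_sum.
pose R (u : envel (so7 K)) (k : K) := euler (Phi (act u hw)) = k *: Phi (act u hw).
rewrite -/(R _ _); elim/big_rec2: _ => [|i k u _ IH]; rewrite /R.
  rewrite [act _ _]ind_act1 Phi_hw scale0r /euler big1 // => c _.
  by rewrite -mpolyC1 mderivC mulr0.
rewrite /verma_act ind_actM Phi_act rho_nilradN // lin_form_euler IH.
by rewrite -scalerAr scalerDl scale1r.
Qed.

Lemma homogeneity_hcart1 d v : homogeneity d v ->
  act (env_in (hcart K 1)) v = (lam - d%:R) *: v.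
Proof.
move=> /homogeneity_euler ev; apply: Phi_inj.
by rewrite Phi_act hcart1E rho_sk00 ev (linZ Phi_linear) scalerBl.
Qed.

(* On a homogeneous vector the two components of the root vector
   g_{eps_1 - eps_2} + g_{eps_3} of G_2 vanish separately, since the first one is
   [h_{eps_1}, g_{eps_1 - eps_2} + g_{eps_3}]. *)
Lemma g2_singular_power d v : g2_singular v -> homogeneity d v ->
  exists N, [/\ d = N.*2, (0 < N)%N -> lam = N%:R - 5 / 2
    & exists2 c, c != 0 & v = c *: act ((4 *: u1 + u2) ^+ N) hw].
Proof.
case=> v0 _ nv sv /homogeneity_hcart1 hv.
have actl : linear (fun x => act (env_in x) v).
  by move=> a x y; rewrite env_in_linear; exact: ind_act_linearl.
have Xv : act (env_in (g2_simple K)) v = 0 by apply: nv; exact: g2_simple_nilrad.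
have gv : act (env_in (gsub K 1 2)) v = 0.
  have <- : lie (hcart K 1) (g2_simple K) = gsub K 1 2.
    have dh : so7_diag (hcart K 1) by exact: sk_diag.
    rewrite (linD (lie_linearr _)) (linZ (lie_linearr _)) !lie_diag_sk //.
    by rewrite !skE -!val_eqE /= !subrr !subr0 scale1r scale0r scaler0 addr0.
  rewrite env_in_lie [act _ _](linB (ind_act_linearl v)) /= !ind_actM.
  rewrite -/(act (env_in (g2_simple K)) v) Xv.
  rewrite -/(act (env_in (hcart K 1)) v) hv (lin0 (ind_act_linearr _)).
  by rewrite (linZ (ind_act_linearr _)) -/(act (env_in (g2_simple K)) v) Xv scaler0 subrr.
have sin x : x \in [:: gsub K 2 3; gsub K 3 2; hcart K 2 - hcart K 3] ->
    act (env_in x) v = 0.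
  by move=> xin; apply: sv; exact: sub_lspan.
apply: (invariant_power (d := d)) => //.
- by apply: sin; rewrite !inE eqxx.
- by apply: sin; rewrite !inE eqxx !orbT.
have := Xv; rewrite (linD actl) gv add0r; exact.
Qed.

Lemma eps_weight (c : K) : exists mu : {scalar so7 K}, forall h, mu h = c * eps 1 h.
Proof.
pose m h := c * eps 1 h.
have ml : scalar m by move=> a x y; rewrite /m /eps so7_DE so7_ZE; ring.
pose mu : {scalar so7 K} := HB.pack m (GRing.isLinear.Build K (so7 K) K *%R m ml).
by exists mu.
Qed.

Lemma power_g2_singular N c v : lam = N%:R - 5 / 2 -> c != 0 ->
  v = c *: act ((4 *: u1 + u2) ^+ N) hw -> g2_singular v.
Proof.
move=> lamN c0 vE; have [v0 kv hv] := power_singular lamN c0 vE.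
split=> //.
- have [mu muE] := eps_weight (lam - (2 * N)%:R).
  by exists mu => h [_ ch]; rewrite muE hv.
- by move=> x /g2_nilrad_kills1 /kv.
- by move=> x /g2_levi_ss_kills1 /kv.
Qed.

Lemma so7_singularP v : (forall c, v <> c *: hw) ->
  so7_singular v <->
  exists2 N : nat, (0 < N)%N & lam = N%:R - 5 / 2 /\
    exists2 c : K, c != 0 & v = c *: act ((4 *: u1 + u2) ^+ N) hw.
Proof.
move=> vhw; split=> [[v0 [mu muv] nv dv]|[N N0 [lamN [c c0 vE]]]]; last first.
  have [v0 kv hv] := power_singular lamN c0 vE; split=> //.
  - have [mu muE] := eps_weight (lam - (2 * N)%:R).
    by exists mu => h ch; rewrite muE hv.
  - by move=> x /nilrad_kills1 /kv.
  - by move=> x /derived_levi_kills1 /kv.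
have ch1 : cartan (hcart K 1) by apply: sub_lspan; rewrite /= !inE eqxx.
have hv := muv _ ch1.
(* No degree is given here. The eigenvalue of h_{eps_1} supplies one: the Euler field multiplies the
   leading coefficient by the degree of the leading monomial. *)
have [d dE] : exists d : nat, mu (hcart K 1) = lam - d%:R.
  have f0 : Phi v != 0 by apply/eqP => /Phi_eq0.
  have := congr1 Phi hv; rewrite Phi_act (linZ Phi_linear) hcart1E rho_sk00 -hcart1E.
  move/(congr1 (mcoeff (mlead (Phi v)))); rewrite mcoeffB !mcoeffZ.
  rewrite /euler raddf_sum /=; under eq_bigr do rewrite mcoeff_Xderivv.
  rewrite sumrMnr -mdegE -mulr_natl -mulrBl => E.
  by exists (mdeg (mlead (Phi v))); apply/esym/(mulIf _ E); rewrite mleadc_eq0.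
rewrite dE in hv.
have dmid a b : a != b -> act (env_in (sk (mid a) (mid b))) v = 0.
  by move=> ab; apply: dv; exact: derived_levi_mid.
have actl : linear (fun x => act (env_in x) v).
  by move=> a x y; rewrite env_in_linear; exact: ind_act_linearl.
have [] := @invariant_power d v _ _ _ _ hv v0.
- have -> : gsub K 2 3 = sk (mid i0) (mid i1) by congr (sk _ _); exact/val_inj.
  exact: dmid.
- apply: dv; rewrite -/(h_long K) -lie_g23; apply: sub_lspan.
  exists (gsub K 2 3), (gsub K 3 2); split=> //.
    have -> : gsub K 2 3 = sk (mid i0) (mid i1) by congr (sk _ _); exact/val_inj.
    exact: levi_mid.
  have -> : gsub K 3 2 = sk (mid i1) (mid i0) by congr (sk _ _); exact/val_inj.
  exact: levi_mid.
- have -> : gshort K 3 = sqrtC 2 *: sk (mid i1) (mid i2).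
    by congr (_ *: sk _ _); exact/val_inj.
  by rewrite (linZ actl) dmid // scaler0.
- by apply: nv; apply: sub_lspan; rewrite /= !inE eqxx ?orbT.
(* N = 0 would make v proportional to v_lambda, which [vhw] excludes. *)
move=> N [_ lamN [c c0 vE]]; case: N lamN vE => [_|N lamN vE].
  by rewrite expr0 /verma_act ind_act1 => /vhw.
by exists N.+1 => //; split; [exact: lamN | exists c].
Qed.

(** * Comparison of coefficients in the family u_1^k u_2^(N-k) *)

Lemma U12_free N (B : 'I_N.+1 -> K) :
  \sum_(k < N.+1) B k *: (U1 ^+ k * U2 ^+ (N - k)) = 0 -> forall k, B k = 0.
Proof.
(* The substitution x_{e_2} = X, x_{e_{-2}} = x_{e_0} = 1 and 0 elsewhere sends U1 to X and U2 to 2,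
   so the products become nonzero multiples of distinct powers of X. *)
pose h (a : 'I_5) : {poly K} := if a == i0 then 'X else if (a == i3) || (a == i2) then 1 else 0.
pose th := mmap (@polyC K) h.
have tX a : th 'X_a = h a by rewrite /th mmapX mmap1U.
have tU1 : th U1 = 'X.
  by rewrite /th rmorphD !rmorphM /= -/th !tX /h -!val_eqE /= mulr1 mul0r addr0.
have tU2 : th U2 = 2%:P.
  by rewrite /th mmapZ rmorphXn /= -/th tX /h -!val_eqE /= expr1n mulr1.
move=> /(congr1 th); rewrite /th raddf_sum raddf0 /=.
under eq_bigr do rewrite mmapZ rmorphM !rmorphXn /= -/th tU1 tU2 -polyC_exp
  mulrA mulrAC -polyCM mul_polyC.
move=> E k; have := congr1 (fun p : {poly K} => p`_k) E; rewrite coef0 coef_sum.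
rewrite (bigD1 k) //= big1 ?addr0 => [|j jk]; last first.
  by rewrite coefZ coefXn eq_sym val_eqE (negPf jk) mulr0.
rewrite coefZ coefXn eqxx mulr1 => /eqP.
by rewrite mulf_eq0 expf_eq0 pnatr_eq0 andbF orbF => /eqP.
Qed.

Lemma u12_comm : GRing.comm (u2 : envel (so7 K)) (4 *: u1).
Proof.
rewrite /u1 /u2 gsub21 gsub31 gaddN12 gaddN13 gshortN1 (linZ (@env_in_linear _ _)).
apply: commr_sym; apply: commrX; apply: commr_sym.
have C a b : GRing.comm (a *: env_in (lower K i2)) (env_in (lower K b)).
  by rewrite /GRing.comm -scalerAl -scalerAr env_lower_comm.
rewrite /GRing.comm -scalerAr -[RHS]scalerAl; congr (_ *: _).
by apply: commrD; apply: commrM; exact: C.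
Qed.

Lemma power_expand N : (4 *: u1 + u2 : envel (so7 K)) ^+ N =
  \sum_(k < N.+1) ('C(N, k)%:R * 4 ^+ k) *: (u1 ^+ k * u2 ^+ (N - k)).
Proof.
rewrite addrC (exprDn_comm _ u12_comm); apply: eq_bigr => k _.
rewrite (commrX _ (commr_sym (commrX _ (commr_sym u12_comm)))) exprZn -scalerAl.
by rewrite -scaler_nat scalerA.
Qed.

Lemma acts_as_family N (A : 'I_N.+1 -> K) :
  Phi (act (\sum_(k < N.+1) A k *: (u1 ^+ k * u2 ^+ (N - k))) hw) =
  \sum_(k < N.+1) A k *: (U1 ^+ k * U2 ^+ (N - k)).
Proof.
rewrite -[RHS]mulr1 -Phi_hw; apply: acts_as_sum => k.
apply: acts_asZ; apply: acts_asM; apply: acts_asX;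
  [exact: acts_as_u1 | exact: acts_as_u2].
Qed.

Lemma sym_mul d e p q :
  @sym_nilradN K d p -> @sym_nilradN K e q -> @sym_nilradN K (d + e) (p * q).
Proof.
have sW := lspan_subspace (fun q => exists2 y : 'I_(d + e) -> so7 K, (forall i, nilradN (y i)) &
                 q = \prod_(i < d + e) env_in (y i)).
move=> Sp Sq; apply: (Sp (fun p => sym_nilradN (d + e) (p * q))).
  split=> [|a u v Su Sv]; first by rewrite mul0r; exact: sW.1.
  by rewrite mulrDl -scalerAl; exact: sW.2.
move=> _ [y ny ->]; apply: (Sq (fun q => sym_nilradN (d + e) (_ * q))).
  split=> [|a u v Su Sv]; first by rewrite mulr0; exact: sW.1.
  by rewrite mulrDr -scalerAr; exact: sW.2.
move=> _ [z nz ->]; apply: sub_lspan.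
exists (fun i => match split i with inl a => y a | inr b => z b end).
  by move=> i; case: split.
rewrite big_split_ord /=; congr (_ * _); apply: eq_bigr => i _.
  by rewrite -[lshift _ _]/(unsplit (inl i)) unsplitK.
by rewrite -[rshift _ _]/(unsplit (inr i)) unsplitK.
Qed.

Lemma sym_gen (y : so7 K) : nilradN y -> sym_nilradN 1 (env_in y).
Proof.
by move=> ny; apply: sub_lspan; exists (fun=> y) => //; rewrite big_ord1.
Qed.

Lemma sym_exp d p k : @sym_nilradN K d p -> sym_nilradN (d * k) (p ^+ k).
Proof.
move=> Sp; elim: k => [|k IH]; last by rewrite mulnS exprS; exact: sym_mul.
rewrite muln0 expr0; apply: sub_lspan; exists (fun=> 0); last by rewrite big_ord0.
by case.
Qed.

Lemma sym_family N (A : 'I_N.+1 -> K) :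
  sym_nilradN (2 * N) (\sum_(k < N.+1) A k *: (u1 ^+ k * u2 ^+ (N - k))).
Proof.
have sW d := lspan_subspace (fun q => exists2 y : 'I_d -> so7 K, (forall i, nilradN (y i)) &
                 q = \prod_(i < d) env_in (y i)).
have gen y : y \in [:: gshortN K 1; gaddN K 1 2; gsub K 2 1; gaddN K 1 3; gsub K 3 1] ->
    sym_nilradN 1 (env_in y).
  by move=> yin; apply: sym_gen; exact: sub_lspan.
have s1 : sym_nilradN 2 (@u1 K).
  apply: (subspaceD (sW 2)); apply: (@sym_mul 1 1); apply: gen;
  by rewrite !inE eqxx ?orbT.
have s2 : sym_nilradN 2 (@u2 K).
  by apply: (@sym_exp 1 _ 2); apply: gen; rewrite !inE eqxx ?orbT.
apply: (subspace_sum _ (sW _)) => k; apply: (subspaceZ _ (sW _)).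
have -> : (2 * N = 2 * k + 2 * (N - k))%N.
  by rewrite -mulnDr subnKC // -ltnS.
by apply: sym_mul; exact: sym_exp.
Qed.

(** Singularity determines only the vector u.v_lambda, whereas the conclusion is an identity in
    U(so(7)). The gap is closed by [U12_free]: equal images in the polynomial ring force equal
    coefficients, those of u being compared with the binomial expansion. *)
Lemma family_singularP N (A : 'I_N.+1 -> K) : (0 < N)%N -> (exists k, A k != 0) ->
  let u : envel (so7 K) := \sum_(k < N.+1) A k *: (u1 ^+ k * u2 ^+ (N - k)) in
  (g2_singular (act u hw) /\ homogeneity (2 * N) (act u hw)) <->
  (lam = N%:R - 5 / 2 /\
   exists2 c : K, c != 0 & u = c *: (4 *: u1 + u2) ^+ N).
Proof.
move=> N0 A0 u; split=> [[sv homv]|[lamN [c c0 uE]]]; last first.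
  split; last by exists u => //; exact: sym_family.
  apply: (power_g2_singular lamN c0).
  by rewrite uE [LHS](linZ (ind_act_linearl _)).
have [M [dM lamM [c c0 vE]]] := g2_singular_power sv homv.
have MN : M = N by apply/double_inj; rewrite -dM mul2n.
rewrite {}MN {M dM} in lamM vE; split; first exact: lamM.
exists c => //; rewrite power_expand scaler_sumr.
pose B k := A k - c * ('C(N, k)%:R * 4 ^+ k).
suff B0 k : B k = 0.
  apply: eq_bigr => k _; rewrite scalerA; congr (_ *: _); apply/eqP.
  by rewrite -subr_eq0 -/(B k) B0.
move: k; apply: U12_free; rewrite /B.
under eq_bigr do rewrite scalerBl -scalerA; rewrite sumrB -scaler_sumr.
rewrite -!acts_as_family -power_expand -/u vE (linZ Phi_linear).
by rewrite subrr.
Qed.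

Lemma no_odd_singular N :
  ~ exists v, g2_singular v /\ homogeneity (2 * N).+1 v.
Proof.
case=> v [sv hv]; have [M [dM _ _]] := g2_singular_power sv hv.
by move/(congr1 odd): dM; rewrite /= mul2n !odd_double.
Qed.
End Singular.

Theorem theorem4p2 (R : realType) (lam : Cplx R) :
  (forall (N : nat) (A : 'I_N.+1 -> Cplx R),
     (0 < N)%N -> (exists k, A k != 0) ->
     let u : envel (so7 (Cplx R)) :=
       \sum_(k < N.+1) A k *: (u1 ^+ k * u2 ^+ (N - k)) in
     (g2_singular (verma_act lam u (verma_hw lam)) /\
      homogeneity (2 * N) (verma_act lam u (verma_hw lam)))
     <->
     (lam = N%:R - 5 / 2 /\
      exists2 c : Cplx R, c != 0 & u = c *: (4 *: u1 + u2) ^+ N))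
  /\
  (forall N : nat, (0 < N)%N ->
     ~ exists v : verma lam, g2_singular v /\ homogeneity (2 * N).+1 v)
  /\
  (forall v : verma lam, (forall c : Cplx R, v <> c *: verma_hw lam) ->
     so7_singular v
     <->
     exists2 N : nat, (0 < N)%N &
       lam = N%:R - 5 / 2 /\
       exists2 c : Cplx R, c != 0 &
         v = c *: verma_act lam ((4 *: u1 + u2) ^+ N) (verma_hw lam)).
Proof.
split; last split.
- by move=> N A; exact: family_singularP.
- by move=> N _; exact: no_odd_singular.
- by move=> v; exact: so7_singularP.
Qed.
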